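(* There are positive constants $c_1,c_2$ such that for every fixed $d\geq 2$, almost surely (as $n\to\infty$) $$2^{c_1d}\, n \leq r(G(n,d/n)) \leq 2^{c_2 d\log^2 d}\, n.$$
   Context: The Ramsey number $r(H)$ of a graph $H$ is the least positive integer $N$ such that every two-coloring of the edges of $K_N$ contains a monochromatic copy of $H$. $G(n,p)$ is the random graph on $n$ labeled vertices in which each edge appears independently with probability $p$; almost surely means with probability tending to $1$ as $n\to\infty$. Logarithms are base $2$. *)

(* Defs.v *)
From HB Require Import structures.
From mathcomp Require Import all_boot all_order all_algebra.
From mathcomp Require Import zify.
Set Implicit Arguments.
Unset Strict Implicit.
Unset Printing Implicit Defensive.
Import Order.TTheory GRing.Theory Num.Theory.

Definition edge (V : finType) := {e : {set V} | #|e| == 2}.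

(* A simple graph with vertex set V is given by its set of edges. *)
Definition graph (V : finType) := {set edge V}.

(* K contains a copy of H, as a not necessarily induced subgraph. Isolated
   vertices of H count: they too are embedded injectively. *)
Definition has_copy (V W : finType) (H : graph V) (K : graph W) : bool :=
  [exists f : {ffun V -> W}, injectiveb f &&
    [forall e in H, [exists e' in K, val e' == f @: val e]]].

Definition colour_class (V : finType) (c : {ffun edge V -> bool}) (b : bool) :
    graph V :=
  [set e | c e == b].

Definition arrows (V : finType) (H : graph V) (N : nat) : bool :=
  [forall c : {ffun edge 'I_N -> bool},
    [exists b : bool, has_copy H (colour_class c b)]].

(* Ramsey's theorem, needed for the least N below to exist. *)
Lemma mono_clique (T : finType) (c : {set T} -> bool) (k s t : nat)
    (A : {set T}) :
  s + t <= k -> 2 ^ k <= #|A| ->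
  exists b : bool, exists2 S : {set T}, #|S| = (if b then s else t)
    & (S \subset A) /\
      (forall x y, x \in S -> y \in S -> x != y -> c [set x; y] = b).
Proof.
elim: k s t A => [|k IHk] s t A.
  rewrite leqn0 addn_eq0 => /andP[/eqP-> _] _.
  exists true, set0; rewrite ?cards0 ?sub0set //.
  by split=> // x y; rewrite in_set0.
move=> le_st leA.
have [->|s_gt0] := posnP s.
  exists true, set0; rewrite ?cards0 ?sub0set //.
  by split=> // x y; rewrite in_set0.
have [->|t_gt0] := posnP t.
  exists false, set0; rewrite ?cards0 ?sub0set //.
  by split=> // x y; rewrite in_set0.
have /card_gt0P[x Ax] : 0 < #|A| by apply: leq_trans leA; rewrite expn_gt0.
pose B b := [set y | [&& y \in A, y != x & c [set x; y] == b]].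
have cardB : #|A| = (#|B true| + #|B false|).+1.
  rewrite (cardsD1 x) Ax add1n; congr _.+1.
  rewrite -(cardsID (B true) (A :\ x)); congr (_ + _); apply: eq_card => y;
    rewrite !inE; case: (y \in A); case: (y == x); case: (c _) => //.
have [b [le_B]] : exists b, 2 ^ k <= #|B b| /\
    (if b then s.-1 + t <= k else s + t.-1 <= k).
  have [le1|lt1] := leqP (2 ^ k) #|B true|; [exists true | exists false];
    split => //; rewrite ?expnS in leA; lia.
have extend (S : {set T}) : S \subset B b ->
    (forall y z, y \in S -> z \in S -> y != z -> c [set y; z] = b) ->
    [/\ #|x |: S| = #|S|.+1, x |: S \subset A &
      forall y z, y \in x |: S -> z \in x |: S -> y != z ->
        c [set y; z] = b].
  move=> sSB cS; have SB y : y \in S -> [/\ y \in A, y != x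
      & c [set x; y] = b].
    by move=> /(subsetP sSB); rewrite inE => /and3P[? ? /eqP].
  split.
  - by rewrite cardsU1; case: (boolP (x \in S)) => // /SB[_]; rewrite eqxx.
  - by rewrite subUset sub1set Ax; apply/subsetP => y /SB[].
  - move=> y z; rewrite !in_setU1.
    case/orP=> [/eqP->|Sy]; case/orP=> [/eqP->|Sz]; rewrite ?eqxx //.
    + by move=> _; case: (SB z Sz).
    + by move=> _; rewrite setUC; case: (SB y Sy).
    + exact: cS.
have sBA : B b \subset A by apply/subsetP => y; rewrite inE => /and3P[].
case: b le_B extend sBA => le_B extend sBA le_k.
- have [[] [S cardS [sSB cS]]] := IHk _ _ _ le_k le_B.
  + have [cardxS sxS cxS] := extend S sSB cS.
    by exists true, (x |: S); rewrite ?cardxS ?cardS ?prednK.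
  + by exists false, S => //; split=> //; apply: subset_trans sBA.
- have [[] [S cardS [sSB cS]]] := IHk _ _ _ le_k le_B.
  + by exists true, S => //; split=> //; apply: subset_trans sBA.
  + have [cardxS sxS cxS] := extend S sSB cS.
    by exists false, (x |: S); rewrite ?cardxS ?cardS ?prednK.
Qed.

Lemma ramsey_exists (V : finType) (H : graph V) :
  exists N, (0 < N) && arrows H N.
Proof.
pose N := 2 ^ (#|V| + #|V|); exists N; rewrite expn_gt0 /=.
apply/forallP => c; pose c' (e : {set 'I_N}) := oapp c false (insub e).
have [|b [S cardS [_ cS]]] := @mono_clique _ c' _ #|V| #|V| [set: 'I_N]
  (leqnn _); first by rewrite cardsT card_ord.
apply/existsP; exists b; have {}cardS : #|V| = #|S| by rewrite cardS; case: b {cS cardS}.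
pose f (v : V) : 'I_N := enum_val (cast_ord cardS (enum_rank v)).
have f_inj : injective f.
  by move=> u v /enum_val_inj/cast_ord_inj/enum_rank_inj.
apply/existsP; exists (finfun f); apply/andP; split.
  by apply/injectiveP => u v; rewrite !ffunE => /f_inj.
apply/forall_inP => e _; have ce : #|f @: val e| == 2.
  by rewrite card_imset // (valP e).
apply/existsP; exists (exist _ (f @: val e) ce); apply/andP; split; last first.
  by apply/eqP/eq_imset => v; rewrite ffunE.
rewrite inE; have /cards2P[u [v [neq_uv def_e]]] := valP e.
have := cS (f u) (f v) (enum_valP _) (enum_valP _).
rewrite (inj_eq f_inj) => /(_ neq_uv) <-; rewrite /c'.
have eq_e : f @: val e = [set f u; f v] by rewrite def_e imsetU1 imset_set1.
by rewrite -eq_e (insubT (fun x : {set _} => #|x| == 2) ce).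
Qed.

Definition ramsey (V : finType) (H : graph V) : nat := ex_minn (ramsey_exists H).

From mathcomp Require Import all_classical all_reals all_analysis.
Import numFieldNormedType.Exports.
Local Open Scope classical_set_scope.
Local Open Scope ring_scope.

(* The probability that G(n, p) equals G; meaningful when 0 <= p <= 1. *)
Definition Gnp_mass (R : realType) (n : nat) (p : R) (G : graph 'I_n) : R :=
  \prod_(e : edge 'I_n) (if e \in G then p else 1 - p).

Definition Gnp_prob (R : realType) (n : nat) (p : R) (P : pred (graph 'I_n)) : R :=
  \sum_(G : graph 'I_n | P G) Gnp_mass p G.

(* Only the tail of p matters: p n may leave [0, 1] for finitely many n. *)
Definition almost_surely (R : realType) (p : nat -> R)
    (P : forall n, pred (graph 'I_n)) : Prop :=
  (fun n => Gnp_prob (p n) (P n)) @ \oo --> (1 : R).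

Definition log2 (R : realType) (x : R) : R := ln x / ln 2.

(* Main.v *)
Require Import Defs.
From mathcomp Require Import all_boot all_order all_algebra.
From mathcomp Require Import zify ring lra.
From mathcomp Require Import reals sequences exp.
Import Order.TTheory GRing.Theory Num.Theory.

(** Upper bound.  Fix a two-colouring with no red copy of H = G(n, d/n).  Almost
    surely H has linearly many edges, at most O(d)|S| edges inside every vertex
    set S, and fewer than 1.5|S| edges inside every small S.  Repeatedly closing
    the set of vertices of high degree under "having two neighbours in the set"
    then gives nested sets shrinking to the empty set, hence a vertex ordering in
    which every vertex has O(d) earlier neighbours and the later neighbours of a
    vertex see only poly(d) different sets of earlier vertices.  With such an
    ordering, greedy embedding in red succeeds in every set U of vertices unless U
    contains two large subsets with few red edges between them.  Iterating this
    O(log d) times, at a loss of a factor 2^(O(d log d)) each time, produces a set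
    of at least 4n vertices with red density O(1/d), where H embeds in blue.

    Lower bound.  For large d, split the vertices into 4^j parts indexed by the
    subsets of a 2j-set and colour pairs between the parts X and Y by the parity
    of |X inter Y|.  The sign matrix is a Hadamard matrix, so however H is
    distributed over the parts about half of all pairs of vertices get each
    colour, and a union bound over the maps from H to the parts applies.  For
    bounded d, make all pairs meeting a set A red and all others blue: a red copy
    needs an independent set of 0.84n vertices in H, a blue copy needs 0.155n
    isolated vertices, and these numbers add up to less than n. *)
Set Implicit Arguments.
Unset Strict Implicit.
Unset Printing Implicit Defensive.

(** * Vertex orderings and embeddings *)

Definition nbh (V : finType) (e : rel V) (x : V) (S : {set V}) : {set V} :=
  [set y in S | e x y].

Definition arcs (V : finType) (e : rel V) (S : {set V}) : nat :=
  \sum_(x in S) #|nbh e x S|.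

Definition adj (V : finType) (G : graph V) : rel V :=
  fun x y => [exists e in G, val e == [set x; y]].

Definition edges_in (V : finType) (G : graph V) (S : {set V}) : {set edge V} :=
  [set e in G | val e \subset S].

Lemma set2_inj (V : finType) (x y z : V) :
  y != x -> z != x -> [set x; y] = [set x; z] -> y = z.
Proof.
move=> yx zx /setP/(_ y); rewrite !inE eqxx orbT (negPf yx) /=.
by move=> /esym/eqP.
Qed.

Lemma adjC (V : finType) (G : graph V) : symmetric (adj G).
Proof. by move=> x y; rewrite /adj setUC. Qed.

Lemma adjxx (V : finType) (G : graph V) : irreflexive (adj G).
Proof.
move=> x; apply: contraTF isT; rewrite /adj => /exists_inP[e _ /eqP ex].
by have := valP e; rewrite ex setUid cards1.
Qed.

Lemma adj_neq (V : finType) (G : graph V) x y : adj G x y -> y != x.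
Proof. by apply: contraTneq => ->; rewrite adjxx. Qed.

Lemma arcs_edges_in (V : finType) (G : graph V) (S : {set V}) :
  arcs (adj G) S <= 2 * #|edges_in G S|.
Proof.
pose E := edges_in G S.
apply: (@leq_trans (\sum_(x in S) #|[set e in E | x \in val e]|)).
  apply: leq_sum => x xS.
  have nb_neq y : y \in nbh (adj G) x S -> y != x by rewrite inE => /andP[_ /adj_neq].
  rewrite -(@card_in_imset _ _ (fun y => [set x; y])); last first.
    by move=> y z /nb_neq yx /nb_neq zx; apply: set2_inj.
  rewrite -[leqRHS](card_imset _ val_inj); apply: subset_leq_card.
  apply/subsetP => z /imsetP[y]; rewrite inE => /andP[yS xy] ->{z}.
  case/exists_inP: xy => e eG /eqP ve; apply/imsetP; exists e => //.
  by rewrite !inE eG ve subUset !sub1set xS yS !inE eqxx.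
rewrite (eq_bigr (fun x => \sum_(e in E) (x \in val e))); last first.
  by move=> x _; rewrite -sum1dep_card big_mkcondr.
rewrite exchange_big /= mulnC -sum_nat_const; apply: leq_sum => e eE.
apply: (@leq_trans #|val e|); last by rewrite (eqP (valP e)).
rewrite -sum1_card [leqRHS]big_mkcond [leqLHS]big_mkcond.
by apply: leq_sum => x _; case: (x \in S); case: (x \in val e).
Qed.

Section Embedding.
Variables (V W : finType) (h : rel V).
Hypotheses (hC : symmetric h) (hxx : irreflexive h).

(* A weak form of arrangeability: when v is embedded, only M candidate sets have
   to stay large, although v may have many more unembedded neighbours. *)
Inductive arranged (D M : nat) : {set V} -> Prop :=
| arranged0 : arranged D M set0
| arrangedU v P : arranged D M P -> v \notin P ->
    (forall u, u \notin P -> #|nbh h u P| <= D) ->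
    #|[set nbh h u P | u in [set u | h v u & u \notin P]]| <= M ->
    arranged D M (v |: P).

Definition common (r : rel W) (U : {set W}) (f : V -> W) (T : {set V}) : {set W} :=
  [set w in U | [forall x in T, r (f x) w]].

Lemma nbhU v u P : nbh h u (v |: P) = if h u v then v |: nbh h u P else nbh h u P.
Proof.
by apply/setP => y; case: ifP => huv; rewrite !inE; case: eqP => //= ->; rewrite huv ?andbF.
Qed.

Lemma sparse_embedding (r : rel W) (U : {set W}) (q t D M : nat) (w0 : W) :
  symmetric r -> 0 < q ->
  (forall X Y : {set W}, X \subset U -> Y \subset U -> t <= #|X| -> t <= #|Y| ->
    exists2 w, w \in X & #|Y| <= q * #|nbh r w Y|) ->
  q ^ D * (M * t + #|V|) <= #|U| ->
  forall P, arranged D M P ->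
  exists f : V -> W, [/\ {in P &, injective f},
    {in P &, forall x y, h x y -> r (f x) (f y)} &
    forall u, u \notin P -> #|U| <= q ^ #|nbh h u P| * #|common r U f (nbh h u P)|].
Proof.
move=> rC q0 good leU P; elim=> [|v {}P _ [f [f_inj f_hom f_cand]] vP leD leM].
  exists (fun=> w0); split=> [x y|x y|u _]; rewrite ?inE //.
  rewrite (_ : nbh _ _ _ = set0) ?cards0 ?mul1n; last by apply/setP => y; rewrite !inE.
  by apply/subset_leq_card/subsetP => w wU; rewrite !inE wU; apply/forall_inP => x; rewrite inE.
have candD u : u \notin P -> M * t + #|V| <= #|common r U f (nbh h u P)|.
  move=> uP; rewrite -(@leq_pmul2l (q ^ D)) ?expn_gt0 ?q0 //.
  apply: leq_trans leU (leq_trans (f_cand _ uP) _).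
  by rewrite leq_mul2r leq_pexp2l ?leD ?orbT.
pose F := [set nbh h u P | u in [set u | h v u & u \notin P]].
pose Cv := common r U f (nbh h v P).
pose bad T := [set w in Cv | q * #|nbh r w (common r U f T)| < #|common r U f T|].
have subU T : common r U f T \subset U by apply/subsetP => w; rewrite inE => /andP[].
have card_bad T : T \in F -> #|bad T| <= t.
  move=> TF; rewrite leqNgt; apply/negP => lt_t.
  have M0 : 0 < M by apply: leq_trans leM; apply/card_gt0P; exists T.
  have leT : t <= #|common r U f T|.
    case/imsetP: TF => u; rewrite inE => /andP[_ /candD le1] ->.
    by apply: leq_trans le1; apply: leq_trans (leq_addr _ _); rewrite leq_pmull.
  have [||||w] := good (bad T) (common r U f T) => //; last 2 first.
  - exact: ltnW.
  - by rewrite inE ltnNge => /andP[_ /negP].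
  - by apply: subset_trans (subU (nbh h v P)); apply/subsetP => w; rewrite inE => /andP[].
have [w wCv] : exists2 w, w \in Cv & (w \notin f @: P) && [forall T in F, w \notin bad T].
  have /subsetPn[w wCv] : ~~ (Cv \subset f @: P :|: \bigcup_(T in F) bad T).
    apply/negP => /subset_leq_card; rewrite leqNgt => /negP; apply.
    apply: leq_trans (candD v vP); rewrite addnC.
    apply: (@leq_trans (#|f @: P| + M * t).+1).
      rewrite ltnS; apply: leq_trans (leq_card_setU _ _) _; rewrite leq_add2l.
      apply: (@leq_trans (\sum_(T in F) t)); last by rewrite sum_nat_const leq_mul2r leM orbT.
      apply: (@leq_trans (\sum_(T in F) #|bad T|)); last exact: leq_sum.
      elim/big_rec2: _ => [|T s A _ le1]; first by rewrite cards0.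
      by apply: leq_trans (leq_card_setU _ _) _; rewrite leq_add2l.
    rewrite -addSn leq_add2r; apply: leq_ltn_trans (leq_imset_card _ _) _.
    by rewrite -cardsT; apply: proper_card; rewrite properE subsetT; apply/subsetPn; exists v.
  rewrite inE negb_or => /andP[w1 w2]; exists w => //; rewrite w1.
  by apply/forall_inP => T TF; apply: contraNN w2 => wT; apply/bigcupP; exists T.
case/andP=> wfP /forall_inP wbad.
pose f' x := if x == v then w else f x.
have f'P x : x \in P -> f' x = f x by rewrite /f'; case: eqP => // -> /(negP vP).
have f'v : f' v = w by rewrite /f' eqxx.
have wadj x : x \in P -> h v x -> r (f x) w.
  by move=> xP hvx; move: wCv; rewrite inE => /andP[_ /forall_inP]; apply; rewrite inE xP.
have common' u : common r U f' (nbh h u P) = common r U f (nbh h u P).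
  apply/setP => y; rewrite !inE; congr (_ && _).
  apply/forall_inP/forall_inP => H x xT; move: (H x xT);
    by rewrite f'P //; move: xT; rewrite inE => /andP[].
exists f'; split.
- move=> x y /setU1P[->|xP] /setU1P[->|yP]; rewrite ?f'v ?f'P //.
  + by move=> wy; case/negP: wfP; apply/imsetP; exists y.
  + by move=> wx; case/negP: wfP; apply/imsetP; exists x.
  + exact: f_inj.
- move=> x y /setU1P[->|xP] /setU1P[->|yP]; rewrite ?f'v ?f'P ?hxx //.
  + by rewrite rC; apply: wadj.
  + by rewrite hC; apply: wadj.
  + exact: f_hom.
move=> u; rewrite !inE negb_or => /andP[uv uP]; rewrite nbhU.
have [huv|_] := boolP (h u v); last by rewrite common'; apply: f_cand.
have vT : v \notin nbh h u P by rewrite inE (negPf vP).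
rewrite cardsU1 vT add1n expnSr -mulnA.
apply: leq_trans (f_cand _ uP) _; rewrite leq_mul2l; apply/orP; right.
have TF : nbh h u P \in F by apply/imsetP; exists u; rewrite // inE hC huv.
have := wbad _ TF; rewrite inE wCv -leqNgt => /leq_trans; apply.
rewrite leq_mul2l; apply/orP; right; apply/subset_leq_card/subsetP => y.
rewrite !inE => /andP[/andP[-> /forall_inP cy] wy] /=.
apply/forall_inP => x /setU1P[->|xT]; first by rewrite f'v.
by move: (xT); rewrite inE => /andP[xP _]; rewrite f'P //; apply: cy.
Qed.

(* The colour used by this embedding is the complement of [r]. *)
Lemma dense_embedding (r : rel W) (U : {set W}) (k D M : nat) (w0 : W) :
  symmetric r ->
  (forall w, w \in U -> #|nbh r w U| <= k) ->
  D * k + #|V| <= #|U| ->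
  forall P, arranged D M P ->
  exists f : V -> W, [/\ {in P &, injective f}, {in P, forall x, f x \in U} &
    {in P &, forall x y, h x y -> ~~ r (f x) (f y)}].
Proof.
move=> rC lek leU P; elim=> [|v {}P _ [f [f_inj fU f_hom]] vP leD _].
  by exists (fun=> w0); split=> [x y|x|x y]; rewrite inE.
have [w wU] : exists2 w, w \in U &
    (w \notin f @: P) && [forall x in nbh h v P, ~~ r (f x) w].
  have /subsetPn[w wU] : ~~ (U \subset f @: P :|: \bigcup_(x in nbh h v P) nbh r (f x) U).
    apply/negP => /subset_leq_card; rewrite leqNgt => /negP; apply.
    apply: leq_trans leU; rewrite addnC.
    apply: (@leq_trans (#|f @: P| + D * k).+1).
      rewrite ltnS; apply: leq_trans (leq_card_setU _ _) _; rewrite leq_add2l.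
      apply: (@leq_trans (\sum_(x in nbh h v P) k)); last first.
        by rewrite sum_nat_const leq_mul2r leD ?orbT.
      apply: (@leq_trans (\sum_(x in nbh h v P) #|nbh r (f x) U|)); last first.
        by apply: leq_sum => x; rewrite inE => /andP[xP _]; apply/lek/fU.
      elim/big_rec2: _ => [|T s A _ le1]; first by rewrite cards0.
      by apply: leq_trans (leq_card_setU _ _) _; rewrite leq_add2l.
    rewrite -addSn leq_add2r; apply: leq_ltn_trans (leq_imset_card _ _) _.
    by rewrite -cardsT; apply: proper_card; rewrite properE subsetT; apply/subsetPn; exists v.
  rewrite inE negb_or => /andP[w1 w2]; exists w => //; rewrite w1.
  apply/forall_inP => x xT; apply: contraNN w2 => rxw; apply/bigcupP; exists x => //.
  by rewrite inE wU.
case/andP=> wfP /forall_inP wbad.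
pose f' x := if x == v then w else f x.
have f'P x : x \in P -> f' x = f x by rewrite /f'; case: eqP => // -> /(negP vP).
have f'v : f' v = w by rewrite /f' eqxx.
have wadj x : x \in P -> h v x -> ~~ r (f x) w.
  by move=> xP hvx; apply: wbad; rewrite inE xP.
exists f'; split.
- move=> x y /setU1P[->|xP] /setU1P[->|yP]; rewrite ?f'v ?f'P //.
  + by move=> wy; case/negP: wfP; apply/imsetP; exists y.
  + by move=> wx; case/negP: wfP; apply/imsetP; exists x.
  + exact: f_inj.
- by move=> x /setU1P[->|xP]; rewrite ?f'v ?f'P //; apply: fU.
- move=> x y /setU1P[->|xP] /setU1P[->|yP]; rewrite ?f'v ?f'P ?hxx //.
  + by rewrite rC; apply: wadj.
  + by rewrite hC; apply: wadj.
  + exact: f_hom.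
Qed.

End Embedding.

Lemma sub_card_exists (T : finType) (A : {set T}) (k : nat) :
  k <= #|A| -> exists2 B : {set T}, B \subset A & #|B| = k.
Proof.
elim: k => [|k IHk] lekA; first by exists set0; rewrite ?sub0set ?cards0.
have [B sBA cB] := IHk (ltnW lekA).
have /subsetPn[x xA xB] : ~~ (A \subset B).
  by apply/negP => /subset_leq_card; rewrite cB leqNgt lekA.
by exists (x |: B); rewrite ?subUset ?sub1set ?xA // cardsU1 xB cB.
Qed.

Lemma card_nbh (V : finType) (r : rel V) x S : #|nbh r x S| = \sum_(y in S) r x y.
Proof. by rewrite -sum1dep_card big_mkcondr. Qed.

Lemma sum_nbhC (V : finType) (r : rel V) (X Y : {set V}) : symmetric r ->
  \sum_(x in X) #|nbh r x Y| = \sum_(y in Y) #|nbh r y X|.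
Proof.
move=> rC; rewrite (eq_bigr _ (fun x _ => card_nbh r x Y)) exchange_big /=.
by apply: eq_bigr => y _; rewrite card_nbh; apply: eq_bigr => x _; rewrite rC.
Qed.

Lemma sum_setU (T : finType) (X Y : {set T}) (F : T -> nat) : [disjoint X & Y] ->
  \sum_(x in X :|: Y) F x = \sum_(x in X) F x + \sum_(x in Y) F x.
Proof. by move=> dXY; rewrite -bigU //; apply: eq_bigl => x; rewrite !inE. Qed.

Lemma arcsU (V : finType) (r : rel V) (X Y : {set V}) : symmetric r -> [disjoint X & Y] ->
  arcs r (X :|: Y) = arcs r X + arcs r Y + 2 * \sum_(y in Y) #|nbh r y X|.
Proof.
move=> rC dXY.
have nbU x : #|nbh r x (X :|: Y)| = #|nbh r x X| + #|nbh r x Y|.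
  by rewrite !card_nbh sum_setU.
rewrite /arcs sum_setU // !(eq_bigr _ (fun x _ => nbU x)) !big_split /=.
by rewrite (sum_nbhC X Y rC); lia.
Qed.

Section Host.
Variables (W : finType) (r : rel W).
Hypothesis rC : symmetric r.

(* Each step pairs two sets that are sparse inside and have density at most
   [2 / q] between them, which nearly halves the density of [r]. *)
Lemma sparse_set (q m K : nat) : 0 < m -> 1 < K ->
  (forall (U : {set W}) (l : nat), m <= l -> K * l <= #|U| ->
    exists X Y : {set W}, [/\ X \subset U, Y \subset U, 4 * l <= #|X|, 4 * l <= #|Y| &
      forall w, w \in X -> q * #|nbh r w Y| < #|Y|]) ->
  forall i (U : {set W}), K ^ i * m <= #|U| ->
  exists S : {set W}, [/\ S \subset U, #|S| = 2 ^ i * m &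
    q * arcs r S <= q * 2 ^ i * m ^ 2 + 2 * (2 ^ i * m) ^ 2].
Proof.
move=> m0 K1 bad; elim=> [|i IHi] U leU.
  have [S sSU cS] := sub_card_exists leU.
  have leS : arcs r S <= #|S| * #|S|.
    rewrite -sum_nat_const; apply: leq_sum => x _.
    by apply/subset_leq_card/subsetP => y; rewrite inE => /andP[].
  rewrite expn0 mul1n in cS; exists S; rewrite expn0 mul1n muln1; split=> //.
  by apply: leq_trans (leq_addr _ _); rewrite leq_mul2l expnS expn1 -cS leS orbT.
pose l := K ^ i * m; pose k := 2 ^ i * m.
have lekl : k <= l by rewrite leq_mul2r; apply/orP; right; case: (i) => [|j] //; rewrite leq_exp2r.
have lml : m <= l by rewrite /l leq_pmull // expn_gt0; lia.
have k0 : 0 < k by rewrite muln_gt0 expn_gt0 m0.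
have {}leU : K * l <= #|U| by rewrite mulnA -expnS.
have [X [Y [sXU sYU leX leY degX]]] := bad _ _ lml leU.
have [|X' [sX'X cX' arcX']] := IHi X; first by rewrite -/l; lia.
rewrite -/k in cX' arcX'.
pose Y1 := [set y in Y | q * #|nbh r y X'| <= 2 * k].
have cY1 : #|Y| <= 2 * #|Y1|.
  have lt1 : q * (\sum_(y in Y) #|nbh r y X'|) <= k * #|Y|.
    rewrite -(sum_nbhC X' Y rC) big_distrr /= -cX' -sum_nat_const; apply: leq_sum => w wX'.
    by apply/ltnW/degX/(subsetP sX'X).
  have le2 : 2 * k * #|Y :\: Y1| <= q * (\sum_(y in Y) #|nbh r y X'|).
    rewrite (big_setID Y1) /= mulnDr; apply: leq_trans (leq_addl _ _).
    rewrite mulnC -sum_nat_const big_distrr /=; apply: leq_sum => y.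
    by rewrite !inE negb_and => /andP[/orP[/negPf->//|]]; rewrite -ltnNge => /ltnW.
  have := cardsID Y1 Y; rewrite (setIidPr _); last by apply/subsetP => y; rewrite inE => /andP[].
  move=> cY; have : 2 * k * #|Y :\: Y1| <= k * #|Y| by apply: leq_trans lt1.
  by rewrite -mulnA mulnCA leq_pmul2l //; lia.
have [|Y' [sY'Y cY' arcY']] := IHi (Y1 :\: X').
  have := cardsID X' Y1; have := subset_leq_card (subsetIr Y1 X').
  by rewrite -/l cX'; lia.
rewrite -/k in cY' arcY'.
have dXY : [disjoint X' & Y'].
  rewrite disjoint_sym disjoints_subset; apply: subset_trans sY'Y _.
  by apply/subsetP => y; rewrite !inE => /andP[].
exists (X' :|: Y'); split.
- rewrite subUset (subset_trans sX'X) //=; apply: subset_trans sY'Y _.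
  by apply: subset_trans sYU; apply/subsetP => y; rewrite !inE => /and3P[].
- by rewrite cardsU (disjoint_setI0 dXY) cards0 cX' cY' expnS /k; lia.
have crossY : q * (\sum_(y in Y') #|nbh r y X'|) <= 2 * k ^ 2.
  rewrite big_distrr /= (@leq_trans (\sum_(y in Y') 2 * k)) //.
    by apply: leq_sum => y /(subsetP sY'Y); rewrite !inE => /and3P[].
  by rewrite sum_nat_const cY'; nia.
rewrite arcsU // expnS.
have -> : (2 * 2 ^ i * m) ^ 2 = 4 * k ^ 2 by rewrite /k !expnMn -mulnA.
lia.
Qed.

End Host.

Definition pair_colour (W : finType) (c : {ffun edge W -> bool}) (s : {set W}) : bool :=
  oapp c false (insub s).

Lemma pair_colourE (W : finType) (c : {ffun edge W -> bool}) (e : edge W) :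
  pair_colour c (val e) = c e.
Proof. by rewrite /pair_colour valK. Qed.

Lemma edge_set2 (V : finType) (e : edge V) :
  exists x y, x != y /\ val e = [set x; y].
Proof. by have /cards2P[x [y [xy ->]]] := valP e; exists x, y. Qed.

Lemma has_copyP (V W : finType) (H : graph V) (c : {ffun edge W -> bool}) b :
  reflect (exists2 f : V -> W, injective f &
            forall e, e \in H -> pair_colour c (f @: val e) = b)
          (has_copy H (colour_class c b)).
Proof.
apply: (iffP idP) => [/existsP[f /andP[/injectiveP f_inj /forall_inP fH]]|[f f_inj fH]].
  exists f => // e /fH /exists_inP[e']; rewrite inE => /eqP <- /eqP <-.
  by rewrite pair_colourE.
apply/existsP; exists (finfun f); apply/andP; split.
  by apply/injectiveP => u v; rewrite !ffunE => /f_inj.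
apply/forall_inP => e eH; have ce : #|f @: val e| == 2 by rewrite card_imset // (valP e).
apply/exists_inP; exists (exist _ (f @: val e) ce); last first.
  by apply/eqP/eq_imset => v; rewrite ffunE.
by rewrite inE -(fH e eH) -pair_colourE.
Qed.

Lemma ramsey_le (V : finType) (H : graph V) (N : nat) : 0 < N -> arrows H N -> ramsey H <= N.
Proof. by move=> N0 HN; rewrite /ramsey; case: ex_minnP => m _; apply; rewrite N0. Qed.

Lemma arrows_ramsey (V : finType) (H : graph V) : arrows H (ramsey H).
Proof. by rewrite /ramsey; case: ex_minnP => m /andP[]. Qed.

Lemma arrows_arranged (V : finType) (H : graph V) (a M : nat) : 0 < #|V| ->
  arranged (adj H) (2 ^ a) M [set: V] ->
  arrows H ((2 ^ ((a + 5) * 2 ^ a) * (4 * M + 1)) ^ (a + 4) * #|V|).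
Proof.
move=> V0 arrH; set K := _ * (4 * M + 1); set N := K ^ _ * _.
pose D := 2 ^ a; pose q := 2 ^ (a + 5).
have KE : K = q ^ D * (4 * M + 1) by rewrite /K /q /D expnM.
have q1 : 1 < q by rewrite /q -(expn0 2) ltn_exp2l // addnS.
have K1 : 1 < K.
  rewrite KE; apply: (@leq_trans (q ^ D)); last by rewrite leq_pmulr ?addn1.
  by rewrite -(expn0 q) ltn_exp2l // /D expn_gt0.
have N0 : 0 < N by rewrite /N muln_gt0 V0 expn_gt0 (ltnW K1).
apply/forallP => c; pose w0 := Ordinal N0.
pose r (x y : 'I_N) := pair_colour c [set x; y].
have rC : symmetric r by move=> x y; rewrite /r setUC.
have [red|nred] := boolP (has_copy H (colour_class c true)).
  by apply/existsP; exists true.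
apply/existsP; exists false; apply/has_copyP.
have leN : K ^ (a + 4) * #|V| <= #|[set: 'I_N]| by rewrite cardsT card_ord.
have [U l lel leU|S [_ cS arcS]] := @sparse_set _ r rC q #|V| K V0 K1 _ (a + 4) setT leN.
  pose bad := [exists X : {set 'I_N}, exists Y : {set 'I_N},
    [&& X \subset U, Y \subset U, 4 * l <= #|X|, 4 * l <= #|Y| &
      [forall w in X, q * #|nbh r w Y| < #|Y|]]].
  have [/existsP[X /existsP[Y /and5P[? ? ? ? /forall_inP ?]]]|nbad] := boolP bad.
    by exists X, Y.
  case/negP: nred; apply/has_copyP.
  have [|X Y sXU sYU leX leY||f [f_inj f_hom _]] :=
    @sparse_embedding _ _ _ (@adjC _ H) (@adjxx _ H) r U q (4 * l) D M w0 rC _ _ _ _ arrH.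
  - exact: ltnW.
  - have : ~~ [forall w in X, q * #|nbh r w Y| < #|Y|].
      apply: contraNN nbad => badXY; apply/existsP; exists X; apply/existsP; exists Y.
      by rewrite sXU sYU leX leY.
    by case/forall_inPn => w wX; rewrite -leqNgt; exists w.
  - apply: leq_trans leU; rewrite KE -mulnA leq_mul2l; apply/orP; right; nia.
  exists f => [x y|e eH]; first by apply: f_inj; rewrite inE.
  have [x [y [_ ve]]] := edge_set2 e.
  rewrite ve imsetU1 imset_set1; apply: f_hom; rewrite ?inE //.
  by apply/exists_inP; exists e; rewrite // ve.
pose n := #|V|; pose S' := [set x in S | #|nbh r x S| <= 4 * n].
have cS' : #|S| = 16 * D * n by rewrite cS expnD /D; lia.
have {}arcS : arcs r S <= 32 * D * n ^ 2.
  have D0 : 0 < D by rewrite expn_gt0.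
  have qE : q = 32 * D by rewrite /q expnD /D; lia.
  rewrite -(@leq_pmul2l q) ?(ltnW q1) //; apply: leq_trans arcS _.
  by rewrite expnD qE -/D -/n; lia.
have cSD : #|S :\: S'| <= 8 * D * n.
  have : 4 * n * #|S :\: S'| <= arcs r S.
    rewrite /arcs (big_setID S') /=; apply: leq_trans (leq_addl _ _).
    rewrite mulnC -sum_nat_const; apply: leq_sum => x.
    by rewrite !inE negb_and => /andP[/orP[/negPf->//|]]; rewrite -ltnNge => /ltnW.
  move=> /leq_trans/(_ arcS); have : 0 < n by []; nia.
have sS'S : S' \subset S by apply/subsetP => x; rewrite inE => /andP[].
have [w wS'||f [f_inj _ f_hom]] :=
  @dense_embedding _ _ _ (@adjC _ H) (@adjxx _ H) r S' (4 * n) D M w0 rC _ _ _ arrH.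
- have : #|nbh r w S| <= 4 * n by move: wS'; rewrite inE => /andP[].
  apply: leq_trans; apply/subset_leq_card/subsetP => y; rewrite !inE.
  by move=> /andP[/andP[-> _] ->].
- have := cardsID S' S; rewrite (setIidPr sS'S) cS' -/n => cc.
  have D0 : 0 < D by rewrite expn_gt0.
  nia.
exists f => [x y|e eH]; first by apply: f_inj; rewrite inE.
have [x [y [_ ve]]] := edge_set2 e.
rewrite ve imsetU1 imset_set1; apply/negbTE; apply: f_hom; rewrite ?inE //.
by apply/exists_inP; exists e; rewrite // ve.
Qed.

(** * Sparse graphs have a good ordering *)

Section Arrange.
Variables (V : finType) (h : rel V).
Hypothesis hC : symmetric h.

Lemma nbhS x (S T : {set V}) : S \subset T -> nbh h x S \subset nbh h x T.
Proof. by move=> /subsetP sST; apply/subsetP => y; rewrite !inE => /andP[/sST->]. Qed.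

Definition closed_set (B : {set V}) : Prop := forall u, u \notin B -> #|nbh h u B| <= 1.

Lemma arranged_layer (A m : nat) (B C : {set V}) :
  (forall S : {set V}, S != set0 -> arcs h S < A * #|S|) ->
  C \subset B -> closed_set B -> closed_set C ->
  (forall v, v \in B -> v \notin C -> #|nbh h v B| < m) ->
  arranged h A m C -> arranged h A m B.
Proof.
move=> sparse sCB clB clC degB arrC.
have A0 v : v \in B -> 0 < A.
  by move=> vB; have := sparse [set v]; rewrite cards1 muln1 -card_gt0 cards1 => /(_ isT); lia.
suff initial k (Q : {set V}) : #|Q| = k -> C \subset Q -> Q \subset B ->
    (forall u, u \in B -> u \notin Q -> #|nbh h u (Q :\: C)| < A) -> arranged h A m Q.
  by apply: (initial _ _ erefl sCB (subxx B)) => u ->.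
elim: k Q => [|k IHk] Q cQ sCQ sQB degQ.
  by move/eqP: cQ; rewrite cards_eq0 => /eqP->; apply: arranged0.
have [/eqP|QC] := boolP (Q :\: C == set0).
  move/eqP; rewrite setD_eq0 => sQC; suff -> : Q = C by [].
  by apply/eqP; rewrite eqEsubset sQC.
have [v vQC degv] : exists2 v, v \in Q :\: C & #|nbh h v (Q :\: C)| < A.
  apply/exists_inP; have := sparse _ QC; apply: contraTT.
  rewrite negb_exists_in -leqNgt mulnC => /forall_inP deg.
  by rewrite -sum_nat_const; apply: leq_sum => v /deg; rewrite -leqNgt.
have [vQ vC] : v \in Q /\ v \notin C by apply/andP; rewrite andbC -in_setD.
pose P := Q :\ v; have vP : v \notin P by rewrite !inE eqxx.
have sPQ : P \subset Q by apply: subsetDl.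
have sCP : C \subset P by rewrite subsetD1 sCQ.
have QE : Q = v |: P by rewrite setD1K.
have sPB := subset_trans sPQ sQB; have vB := subsetP sQB _ vQ.
have degP u : u \in B -> u \notin P -> #|nbh h u (P :\: C)| < A.
  move=> uB; rewrite in_setD1 negb_and negbK => uP.
  apply: (@leq_ltn_trans #|nbh h u (Q :\: C)|); first by apply/subset_leq_card/nbhS/setSD.
  by case/orP: uP => [/eqP->//|uQ]; apply: degQ.
rewrite QE; apply: arrangedU => //.
- by apply: IHk => //; move: cQ; rewrite QE cardsU1 vP => -[].
- move=> u uP; have [uB|uB] := boolP (u \in B); last first.
    apply: leq_trans (A0 _ vB); apply: leq_trans (clB _ uB).
    exact/subset_leq_card/nbhS.
  have uC : u \notin C by apply: contraNN uP => /(subsetP sCP).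
  have -> : nbh h u P = nbh h u C :|: nbh h u (P :\: C).
    apply/setP => y; rewrite !inE; have := subsetP sCP y; rewrite !inE.
    by case: (y \in C) => //= ->; rewrite ?andbF ?orbF.
  apply: leq_trans (leq_card_setU _ _) _.
  by apply: leq_trans (leq_add (clC _ uC) (leqnn _)) _; rewrite add1n; apply: degP.
apply: leq_trans (degB _ vB vC).
have -> : #|nbh h v B|.+1 = 1 + #|nbh h v B| by [].
rewrite -(cards1 (@set0 V)).
apply: (@leq_trans #|[set set0] :|: (fun u => nbh h u P) @: nbh h v B|); last first.
  by apply: leq_trans (leq_card_setU _ _) _; rewrite leq_add2l leq_imset_card.
apply/subset_leq_card/subsetP => T /imsetP[u]; rewrite inE => /andP[hvu uP] ->{T}.
have [uB|uB] := boolP (u \in B).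
  by apply/setUP; right; apply: imset_f; rewrite inE uB.
apply/setUP; left; rewrite inE; apply/eqP/setP => y; rewrite [RHS]inE.
apply/negP; rewrite inE => /andP[yP huy].
have := clB _ uB; apply/negP; rewrite -ltnNge.
have yv : y != v by apply: contraNneq vP => <-.
apply: (@leq_trans #|[set y; v]|); first by rewrite cards2 yv.
apply/subset_leq_card/subsetP => z.
by rewrite !inE => /orP[]/eqP->; rewrite ?huy ?vB ?(subsetP sPB) // hC.
Qed.

(* Adding to X a vertex with two neighbours in X adds four arcs, so a hull of more
   than [4 * #|X0|] vertices would contain a small set that is too dense. *)
Lemma closed_hull (delta : nat) (B X0 : {set V}) :
  (forall (S : {set V}) b, 0 < b -> delta * b <= #|V| -> #|S| = 4 * b -> arcs h S < 12 * b) ->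
  delta * #|X0| <= #|V| -> X0 \subset B -> closed_set B ->
  exists X : {set V}, [/\ X0 \subset X, X \subset B, closed_set X & #|X| <= 4 * #|X0|].
Proof.
move=> sparse leX0 sX0B clB; set b := #|X0|.
have [b0|b_gt0] := posnP b.
  exists X0; split=> //; rewrite -/b ?b0 //.
  move=> u _; apply: (@leq_trans b); last by rewrite b0.
  by apply/subset_leq_card/subsetP => y; rewrite inE => /andP[].
pose fam (X : {set V}) := [&& X0 \subset X, X \subset B, #|X| <= 4 * b &
  4 * #|X| <= arcs h X + 4 * b].
have famX0 : fam X0 by rewrite /fam subxx sX0B -/b leq_addl leq_pmull.
case: (@arg_maxnP _ X0 fam (fun X : {set V} => #|X|) famX0) => X.
move=> /and4P[sX0X sXB leX arcX] maxX.
exists X; split=> // u uX; rewrite leqNgt; apply/negP => lt1.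
have uB : u \in B.
  apply: contraLR lt1 => /clB le1; rewrite -leqNgt; apply: leq_trans le1.
  exact/subset_leq_card/nbhS.
have ltX : #|X| < 4 * b.
  rewrite ltn_neqAle leX andbT; apply/eqP => cX.
  by have := sparse X b b_gt0 leX0 cX; lia.
have /maxX : fam (u |: X); last by rewrite cardsU1 uX; lia.
rewrite /fam subUset sub1set uB sXB cardsU1 uX (subset_trans sX0X) ?subsetUr //=.
rewrite add1n ltX /= setUC arcsU //; last by rewrite disjoint_sym disjoints1.
by rewrite big_set1; lia.
Qed.

Lemma sparse_arranged (A delta : nat) : 0 < delta ->
  (forall S : {set V}, S != set0 -> arcs h S < A * #|S|) ->
  (forall (S : {set V}) b, 0 < b -> delta * b <= #|V| -> #|S| = 4 * b -> arcs h S < 12 * b) ->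
  arranged h A (4 * A * delta).+1 [set: V].
Proof.
move=> d0 sparse1 sparse2.
suff layers k (B : {set V}) : #|B| <= k -> closed_set B -> arranged h A (4 * A * delta).+1 B.
  by apply: (layers _ _ (leqnn _)) => u; rewrite inE.
elim: k B => [|k IHk] B leB clB.
  by move: leB; rewrite leqn0 cards_eq0 => /eqP->; apply: arranged0.
have [->|B0] := eqVneq B set0; first exact: arranged0.
pose m := 4 * A * delta; pose X0 := [set v in B | m < #|nbh h v B|].
have cX0 : m * #|X0| < A * #|B|.
  apply: leq_ltn_trans (sparse1 _ B0); rewrite mulnC -sum_nat_const.
  rewrite /arcs [leqRHS](big_setID X0) /=; apply: leq_trans (leq_addr _ _).
  rewrite (setIidPr _); last by apply/subsetP => y; rewrite inE => /andP[].
  by apply: leq_sum => v; rewrite inE => /andP[_ /ltnW].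
have {}cX0 : 4 * delta * #|X0| < #|B|.
  move: cX0; rewrite /m.
  have -> : 4 * A * delta * #|X0| = A * (4 * delta * #|X0|) by rewrite !mulnA (mulnC 4).
  by rewrite ltn_mul2l => /andP[].
have leBV : #|B| <= #|V| := max_card _.
have cXd : #|X0| <= delta * #|X0| by rewrite leq_pmull.
have [|||X [sX0X sXB clX cX]] := @closed_hull delta B X0 sparse2 => //.
- by move: cX0 leBV; rewrite -mulnA; lia.
- by apply/subsetP => v; rewrite inE => /andP[].
apply: (arranged_layer sparse1 sXB clB clX).
  move=> v vB; apply: contraNltn => /= lev; apply: (subsetP sX0X).
  by rewrite inE vB.
by apply: IHk => //; move: cX0 cX cXd leB; rewrite -mulnA; lia.
Qed.

End Arrange.

(** * Colourings without large monochromatic copies *)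

Lemma sum_setT (T : finType) (F : T -> nat) : \sum_(x in [set: T]) F x = \sum_x F x.
Proof. by apply: eq_bigl => x; rewrite inE. Qed.

Lemma card_ord_le (N k : nat) (A : {set 'I_N}) (phi : nat -> nat) :
  {in A &, forall i j : 'I_N, phi i = phi j -> i = j} ->
  (forall i : 'I_N, i \in A -> phi i < k) -> #|A| <= k.
Proof.
move=> phi_inj phi_lt; rewrite cardE -(size_iota 0 k) -(size_map (fun i : 'I_N => phi i)).
apply: uniq_leq_size.
  rewrite map_inj_in_uniq ?enum_uniq // => i j.
  by rewrite !mem_enum => iA jA /(phi_inj _ _ iA jA).
by move=> z /mapP[i]; rewrite mem_enum => /phi_lt ltk ->{z}; rewrite mem_iota.
Qed.

Lemma edge_exists (V : finType) (x y : V) :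
  x != y -> exists e : edge V, val e = [set x; y].
Proof.
move=> xy; have cxy : #|[set x; y]| == 2 by rewrite cards2 xy.
by exists (exist (fun A : {set V} => #|A| == 2) _ cxy).
Qed.

(* The edges that rule out a copy in colour [b] placed in the parts according to [g]. *)
Definition offending (V K : finType) (s : rel K) (g : {ffun V -> K}) (b : bool) : graph V :=
  [set e | [exists x, exists y, (val e == [set x; y]) && (s (g x) (g y) != b)]].

Lemma offendingP (V K : finType) (s : rel K) (g : {ffun V -> K}) b x y :
  x != y -> s (g x) (g y) != b -> adj (offending s g b) x y.
Proof.
move=> xy sb; have [e ve] := edge_exists xy.
apply/exists_inP; exists e; last by rewrite ve.
by rewrite inE; apply/existsP; exists x; apply/existsP; exists y; rewrite ve eqxx.
Qed.

Lemma arrows_parts (V K : finType) (H : graph V) (N : nat) (part : 'I_N -> K) (s : rel K) :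
  symmetric s -> arrows H N ->
  exists b (g : {ffun V -> K}), [disjoint H & offending s g b] /\
    forall k, #|[set x | g x == k]| <= #|[set i | part i == k]|.
Proof.
move=> sC /forallP/(_ [ffun e : edge 'I_N =>
  [exists x, exists y, (val e == [set x; y]) && s (part x) (part y)]]) /existsP[b].
move=> /has_copyP[f f_inj fH]; exists b, [ffun x => part (f x)]; split; last first.
  move=> k; rewrite -(card_imset _ f_inj); apply/subset_leq_card/subsetP => i.
  by case/imsetP => x; rewrite !inE ffunE => xk ->.
rewrite disjoint_subset; apply/subsetP => e eH; rewrite !inE; apply/negP; case/existsP => x.
case/existsP => y /andP[/eqP ve]; rewrite !ffunE => /eqP; case.
have := fH e eH; rewrite ve imsetU1 imset_set1.
have xy : x != y by have := valP e; rewrite ve cards2; case: (x == y).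
have fxy : f x != f y by rewrite (inj_eq f_inj).
have [e' ve'] := edge_exists fxy.
rewrite -ve' pair_colourE ffunE ve' => <-; apply/idP/idP.
  by move=> sxy; apply/existsP; exists (f x); apply/existsP; exists (f y); rewrite eqxx.
case/existsP => u /existsP[v /andP[/eqP uv]].
have uu : u \in [set f x; f y] by rewrite uv !inE eqxx.
have vv : v \in [set f x; f y] by rewrite uv !inE eqxx orbT.
have u_v : u != v by have := valP e'; rewrite ve' uv cards2; case: (u == v).
move: uu vv u_v; rewrite !inE => /orP[]/eqP-> /orP[]/eqP->; rewrite ?eqxx // => _.
by rewrite sC.
Qed.

Lemma balanced_parts (K : finType) (N w : nat) : N <= #|K| * w ->
  exists part : 'I_N -> K, forall k, #|[set i | part i == k]| <= w.
Proof.
move=> leN; have lt_div (i : 'I_N) : i %/ w < #|K|.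
  have := ltn_ord i; case: w leN => [|w] leN lti; first by lia.
  by rewrite ltn_divLR //; apply: leq_trans leN.
exists (fun i => enum_val (Ordinal (lt_div i))) => k.
apply: (@card_ord_le _ _ _ (fun i => i %% w)) => [i j|i _]; last first.
  by have := ltn_ord i; case: (w) leN => [|w'] leN lti; [lia | rewrite ltn_mod].
rewrite !inE => /eqP <- /eqP/enum_val_inj[eq_div] eq_mod; apply: val_inj => /=.
by rewrite (divn_eq i w) (divn_eq j w) eq_div eq_mod.
Qed.

Lemma arrows_split (V : finType) (H : graph V) (N a b : nat) :
  N <= a + b -> arrows H N ->
  (exists2 S : {set V}, #|V| <= #|S| + a & forall e, e \in H -> ~~ (val e \subset S)) \/
  (exists2 S : {set V}, #|V| <= #|S| + b & forall e, e \in H -> [disjoint val e & S]).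
Proof.
move=> leN arrH.
have orC : symmetric orb by move=> [] [].
have [beta [g [dis leg]]] := arrows_parts (fun i : 'I_N => i < a) orC arrH.
have lea : #|[set i : 'I_N | (i < a) == true]| <= a.
  by apply: (@card_ord_le _ _ _ id) => [i j _ _ /val_inj|i] //; rewrite inE => /eqP.
have leb : #|[set i : 'I_N | (i < a) == false]| <= b.
  apply: (@card_ord_le _ _ _ (fun i => i - a)) => [i j|i]; rewrite !inE => /eqP.
    by move=> ai /eqP aj ij; apply: val_inj => /=; move: ai aj => /negbT ? /negbT ?; lia.
  by have := ltn_ord i; lia.
have cV : #|V| = #|[set x | g x == true]| + #|[set x | g x == false]|.
  rewrite -(cardC [set x | g x == true]); congr (_ + _); apply: eq_card => x.
  by rewrite !inE; case: (g x).
have noedge e x y : e \in H -> val e = [set x; y] -> g x || g y = beta.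
  move=> eH ve; apply/eqP; move/disjoint_setI0/setP/(_ e): dis; rewrite !inE eH /=.
  move/negbT; rewrite negb_exists => /forallP/(_ x); rewrite negb_exists => /forallP/(_ y).
  by rewrite ve eqxx /= negbK.
case: beta dis noedge => dis noedge; [left; exists [set x | g x == false] |
  right; exists [set x | g x == true]].
- by rewrite cV addnC leq_add2l (leq_trans (leg true)).
- move=> e eH; have [x [y [_ ve]]] := edge_set2 e.
  have := noedge e x y eH ve; rewrite ve subUset !sub1set !inE.
  by case: (g x); case: (g y).
- by rewrite cV leq_add2l (leq_trans (leg false)).
- move=> e eH; have [x [y [_ ve]]] := edge_set2 e.
  have := noedge e x y eH ve; rewrite ve disjoints_subset subUset !sub1set !inE.
  by case: (g x); case: (g y).
Qed.

Local Open Scope ring_scope.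

Section Hadamard.
Variable r : nat.

Let K := {set 'I_r}.

Definition odd_meet : rel K := fun X Y => odd #|X :&: Y|.

Definition hadamard (X Y : K) : int := (-1) ^+ odd_meet X Y.

Lemma odd_meetC : symmetric odd_meet.
Proof. by move=> X Y; rewrite /odd_meet setIC. Qed.

Lemma hadamardE X Y : hadamard X Y = \prod_i (if i \in X then (-1) ^+ (i \in Y) else 1).
Proof.
rewrite /hadamard signr_odd -sum1_card -prodrXr big_mkcond; apply: eq_bigr => i _.
by rewrite inE; case: (i \in X); case: (i \in Y).
Qed.

Lemma hadamard_orthogonal Y Z :
  \sum_X hadamard X Y * hadamard X Z = (2 ^ r * (Y == Z))%:R.
Proof.
pose s i : int := (-1) ^+ (i \in Y) * (-1) ^+ (i \in Z).
have -> : \sum_X hadamard X Y * hadamard X Z = \prod_(i < r) (s i + 1).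
  rewrite bigA_distr; apply: eq_bigr => X _; rewrite !hadamardE -big_split /=.
  by apply: eq_bigr => i _; case: ifP => _; rewrite ?mulr1.
have [eqYZ|neqYZ] := eqVneq Y Z.
  rewrite muln1 (eq_bigr (fun=> 2%:R)) ?prodr_const ?card_ord ?natrX // => i _.
  by rewrite /s eqYZ -signr_addb addbb.
have [i si] : exists i, (i \in Y) != (i \in Z).
  by apply/existsP; apply: contraNT neqYZ => /existsPn eqYZ; apply/eqP/setP => i;
    apply/eqP; rewrite -[_ == _]negbK.
rewrite muln0 (bigD1 i) //= /s; move: si; case: (i \in Y); case: (i \in Z) => //=;
  by rewrite ?mulr1 ?mul1r addrC subrr mul0r.
Qed.

Variables (V : finType) (g : {ffun V -> K}).

Let same : nat := (\sum_x \sum_y (g x == g y))%N.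

Lemma hadamard_discrepancy j : r = j.*2 ->
  `|\sum_x \sum_y hadamard (g x) (g y)| <= (2 ^ j * same)%:R.
Proof.
move=> rE; pose t : int := (2 ^ j)%:R; have t0 : 0 < t by rewrite ltr0n expn_gt0.
have t2 : t * t = (2 ^ r)%:R by rewrite -natrM -expnD addnn rE.
pose a X : int := \sum_x (g x == X)%:R; pose B X := \sum_y hadamard X (g y).
set Q := \sum_x _.
have QE : Q = \sum_X a X * B X.
  under [RHS]eq_bigr => X _ do rewrite mulr_suml.
  rewrite exchange_big; apply: eq_bigr => x _ /=.
  rewrite [RHS](bigD1 (g x)) //= eqxx mul1r [X in _ = _ + X]big1 ?addr0 // => X.
  by rewrite eq_sym => /negPf->; rewrite mul0r.
have sumB : \sum_X B X ^+ 2 = t * t * same%:R.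
  under eq_bigr => X _ do rewrite expr2 big_distrlr /=.
  rewrite exchange_big /= /same natr_sum mulr_sumr; apply: eq_bigr => y _.
  rewrite exchange_big natr_sum mulr_sumr; apply: eq_bigr => z _ /=.
  by rewrite hadamard_orthogonal t2 natrM.
have suma : \sum_X a X ^+ 2 = same%:R.
  under eq_bigr => X _ do rewrite expr2 big_distrlr /=.
  rewrite exchange_big /= /same natr_sum; apply: eq_bigr => y _.
  rewrite exchange_big natr_sum; apply: eq_bigr => z _ /=.
  rewrite (bigD1 (g y)) //= eqxx mul1r big1 ?addr0 ?[g z == _]eq_sym // => X.
  by rewrite eq_sym => /negPf->; rewrite mul0r.
(* AM-GM applied to [t * a X] and [B X], whose square sums are both [t * t * same]. *)
have bound (e : int) : e * e = 1 -> 2 * t * (e * Q) <= 2 * t * (t * same%:R).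
  move=> e2; rewrite QE !mulr_sumr.
  apply: (@le_trans _ _ (\sum_X (t * t * a X ^+ 2 + B X ^+ 2))); last first.
    by rewrite big_split /= -mulr_sumr suma sumB; lia.
  apply: ler_sum => X _; rewrite -subr_ge0.
  have -> : t * t * a X ^+ 2 + B X ^+ 2 - 2 * t * (e * (a X * B X)) =
      (t * a X - e * B X) ^+ 2 + (1 - e * e) * B X ^+ 2 by ring.
  by rewrite e2 subrr mul0r addr0 sqr_ge0.
rewrite natrM -/t ler_norml; apply/andP; split.
  rewrite lerNl -mulN1r -(@ler_pM2l _ (2 * t)) ?mulr_gt0 //; exact: bound.
by rewrite -[Q]mul1r -(@ler_pM2l _ (2 * t)) ?mulr_gt0 //; exact: bound.
Qed.

Lemma card_offending (j w : nat) b : r = j.*2 ->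
  (forall X, #|[set x | g x == X]| <= w)%N -> (3 * 2 ^ j * w <= #|V|)%N ->
  (#|V| ^ 2 <= 6 * #|offending odd_meet g b| + 3 * #|V|)%N.
Proof.
move=> rE lew le_n; set n := #|V|.
have same_le : (same <= n * w)%N.
  rewrite /same -sum_nat_const; apply: leq_sum => x _; apply: leq_trans (lew (g x)).
  by rewrite -sum1dep_card [leqRHS]big_mkcond; apply: leq_sum => y _; rewrite eq_sym; case: eqP.
pose cnt := (\sum_x \sum_y (odd_meet (g x) (g y) != b))%N.
have pt x y : 1 = 2 * (odd_meet (g x) (g y) != b)%:R + (-1) ^+ b * hadamard (g x) (g y) :> int.
  by rewrite /hadamard; case: odd_meet; case: (b).
have cntE : (n ^ 2)%:R = 2 * cnt%:R + (-1) ^+ b * \sum_x \sum_y hadamard (g x) (g y).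
  have -> : (n ^ 2)%:R = \sum_(x : V) \sum_(y : V) (1 : int).
    by rewrite !sumr_const -mulrnA mulnn.
  rewrite /cnt natr_sum !mulr_sumr -big_split /=; apply: eq_bigr => x _.
  rewrite natr_sum !mulr_sumr -big_split /=; apply: eq_bigr => y _.
  exact: pt.
have cnt_ge : (n ^ 2 <= 2 * cnt + 2 ^ j * (n * w))%N.
  have := hadamard_discrepancy rE; move: cntE; set Q := \sum_x _ => cntE leQ.
  have : (-1) ^+ b * Q <= `|Q| by case: (b); rewrite ?expr0 ?expr1; lia.
  have : (2 ^ j * same <= 2 ^ j * (n * w))%N by rewrite leq_mul2l same_le orbT.
  lia.
have cnt_le : (cnt <= 2 * #|offending odd_meet g b| + n)%N.
  have le1 := arcs_edges_in (offending odd_meet g b) [set: V].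
  have le2 : (#|edges_in (offending odd_meet g b) [set: V]| <= #|offending odd_meet g b|)%N.
    by apply/subset_leq_card/subsetP => e; rewrite inE => /andP[].
  apply: (@leq_trans (arcs (adj (offending odd_meet g b)) setT + n)); last by lia.
  rewrite -[n]sum1_card /arcs sum_setT -big_split /=; apply: leq_sum => x _.
  rewrite card_nbh sum_setT (bigD1 x) //= addnC; apply: leq_add; last by case: (_ != _).
  rewrite [leqRHS](bigD1 x) //=; apply: leq_trans (leq_addl _ _).
  apply: leq_sum => y yx; case: (boolP (_ != b)) => // sb.
  by rewrite (offendingP _ sb) // eq_sym.
have : (n * (3 * 2 ^ j * w) <= n * n)%N by rewrite leq_mul2l le_n orbT.
lia.
Qed.

End Hadamard.

(** * First-moment estimates in G(n, p) *)

Section Gnp.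
Variables (R : realType) (n : nat) (p : R).

Lemma Gnp_probE (P : pred (graph 'I_n)) :
  Gnp_prob p P = \sum_(G : graph 'I_n) (P G)%:R * Gnp_mass p G.
Proof.
by rewrite /Gnp_prob big_mkcond; apply: eq_bigr => G _; case: (P G); rewrite ?mul1r ?mul0r.
Qed.

Lemma Gnp_prob_total : Gnp_prob p (fun _ : graph 'I_n => true) = 1.
Proof.
rewrite /Gnp_prob /Gnp_mass -[LHS]/(\sum_(G : {set edge 'I_n}) _) -bigA_distr.
by apply: big1 => e _; rewrite /= addrC subrK.
Qed.

Lemma Gnp_prob_sub (F : graph 'I_n) :
  Gnp_prob p (fun G : graph 'I_n => F \subset G) = p ^+ #|F|.
Proof.
have -> : p ^+ #|F| = \prod_e (p + (if e \in F then 0 else 1 - p)).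
  rewrite -prodr_const big_mkcond; apply: eq_bigr => e _.
  by case: (e \in F); rewrite ?addr0 //; lra.
rewrite bigA_distr Gnp_probE; apply: eq_bigr => G _.
have [sFG|/subsetPn[e eF eG]] := boolP (F \subset G).
  rewrite mul1r; apply: eq_bigr => e _.
  by have := subsetP sFG e; case: (e \in F) => //= ->.
by rewrite mul0r (bigD1 e) //= eF (negPf eG) mul0r.
Qed.

Lemma Gnp_prob_disjoint (F : graph 'I_n) :
  Gnp_prob p (fun G : graph 'I_n => [disjoint G & F]) = (1 - p) ^+ #|F|.
Proof.
have -> : (1 - p) ^+ #|F| = \prod_e ((if e \in F then 0 else p) + (1 - p)).
  rewrite -prodr_const big_mkcond; apply: eq_bigr => e _.
  by case: (e \in F); rewrite ?add0r //; lra.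
rewrite bigA_distr Gnp_probE; apply: eq_bigr => G _.
have [dGF|ndGF] := boolP [disjoint G & F].
  rewrite mul1r; apply: eq_bigr => e _.
  by have [eG|//] := boolP (e \in G); rewrite (disjointFr dGF eG).
have /pred0Pn[e /andP[/= eG eF]] := ndGF.
by rewrite mul0r (bigD1 e) //= eF eG mul0r.
Qed.

Hypothesis p01 : 0 <= p <= 1.

Lemma Gnp_mass_ge0 (G : graph 'I_n) : 0 <= Gnp_mass p G.
Proof. by apply: prodr_ge0 => e _; case: ifP => _; case/andP: p01; lra. Qed.

Lemma Gnp_prob_union (I : finType) (Q : pred I) (E : I -> pred (graph 'I_n))
    (P : pred (graph 'I_n)) (k : nat) :
  (forall G, P G -> (k <= #|[set i | Q i && E i G]|)%N) ->
  k%:R * Gnp_prob p P <= \sum_(i | Q i) Gnp_prob p (E i).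
Proof.
move=> covered; under eq_bigr => i _ do rewrite Gnp_probE.
rewrite exchange_big /= /Gnp_prob mulr_sumr big_mkcond; apply: ler_sum => G _.
rewrite -mulr_suml; case: ifP => [PG|_]; last first.
  by apply: mulr_ge0; rewrite ?Gnp_mass_ge0 ?sumr_ge0.
apply: ler_wpM2r; first exact: Gnp_mass_ge0.
apply: (@le_trans _ _ (#|[set i | Q i && E i G]|)%:R); first by rewrite ler_nat covered.
by rewrite -sum1dep_card natr_sum big_mkcondr; apply: ler_sum => i _; case: (E i G).
Qed.

Lemma Gnp_prob_exists (I : finType) (Q : pred I) (E : I -> pred (graph 'I_n))
    (P : pred (graph 'I_n)) :
  (forall G, P G -> exists2 i, Q i & E i G) ->
  Gnp_prob p P <= \sum_(i | Q i) Gnp_prob p (E i).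
Proof.
move=> covered; rewrite -[leLHS]mul1r; apply: (Gnp_prob_union (k := 1%N)) => G.
move=> /covered[i Qi Ei].
by apply/card_gt0P; exists i; rewrite inE Qi.
Qed.

Lemma Gnp_prob_or (P P1 P2 : pred (graph 'I_n)) : (forall G, P G -> P1 G || P2 G) ->
  Gnp_prob p P <= Gnp_prob p P1 + Gnp_prob p P2.
Proof.
move=> PP; rewrite !Gnp_probE -big_split; apply: ler_sum => G _ /=.
rewrite -mulrDl; apply: ler_wpM2r; first exact: Gnp_mass_ge0.
by have := PP G; rewrite -natrD ler_nat; case: (P G) => [/(_ isT)|_]; case: (P1 G); case: (P2 G).
Qed.

Lemma Gnp_prob_le (P Q : pred (graph 'I_n)) :
  (forall G, P G -> Q G) -> Gnp_prob p P <= Gnp_prob p Q.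
Proof.
move=> PQ; rewrite !Gnp_probE; apply: ler_sum => G _.
apply: ler_wpM2r; first exact: Gnp_mass_ge0.
by rewrite ler_nat; case PG: (P G) => //; rewrite PQ.
Qed.

Lemma Gnp_prob_le1 (P : pred (graph 'I_n)) : Gnp_prob p P <= 1.
Proof.
rewrite -Gnp_prob_total !Gnp_probE; apply: ler_sum => G _; apply: ler_wpM2r.
  exact: Gnp_mass_ge0.
by case: (P G).
Qed.

Lemma Gnp_probC (P : pred (graph 'I_n)) :
  Gnp_prob p P = 1 - Gnp_prob p (fun G => ~~ P G).
Proof.
rewrite -Gnp_prob_total !Gnp_probE -sumrB; apply: eq_bigr => G _.
by case: (P G); rewrite /= ?mul1r ?mul0r ?subr0 ?subrr.
Qed.

End Gnp.

Lemma exp1B_le (R : realType) (p : R) (m : nat) : p <= 1 -> (1 - p) ^+ m <= expR (- (p * m%:R)).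
Proof.
move=> p1; rewrite -mulNr expRM_natr; apply: lerXn2r; rewrite ?nnegrE ?expR_ge0 //.
  by rewrite subr_ge0.
exact: expR_ge1Dx.
Qed.

Lemma expR1_le3 (R : realType) : expR 1 <= 3 :> R.
Proof.
have e0 := expR_gt0 (8^-1 : R).
have e8 : expR 1 = expR 8^-1 ^+ 8 :> R by rewrite -expRM_natr mulVf ?pnatr_eq0.
have lt8 : expR 8^-1 <= 8 / 7 :> R.
  have : expR 8^-1 * (1 + - 8^-1) <= 1 :> R.
    by rewrite -[leRHS](mulfV (lt0r_neq0 e0)) ler_pM2l // -expRN expR_ge1Dx.
  by lra.
rewrite e8; apply: (@le_trans _ _ ((8 / 7) ^+ 8)); last by lra.
by apply: lerXn2r; rewrite ?nnegrE ?(ltW e0) //; lra.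
Qed.

Lemma expnn_le_fact (R : realType) (k : nat) : (k%:R : R) ^+ k <= 3 ^+ k * k`!%:R.
Proof.
case: k => [|k]; first by rewrite !expr0 mul1r.
rewrite -ler_pdivrMr ?ltr0n ?fact_gt0 //.
apply: (@le_trans _ _ (expR k.+1%:R)).
  by have := @expR_ge1Dxn R k.+1%:R k (ler0n _ _); lra.
rewrite -[k.+1%:R]mul1r expRM_natr; apply: lerXn2r; rewrite ?nnegrE ?expR_ge0 //.
exact: expR1_le3.
Qed.

Lemma bin_le_expn (n k : nat) : ('C(n, k) * k`! <= n ^ k)%N.
Proof.
rewrite bin_ffact; elim: k n => [|k IHk] n; first by rewrite ffactn0.
case: n => [|n]; first by rewrite ffact0n.
rewrite ffactnS expnS leq_mul2l /= (leq_trans (IHk _)) //.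
by case: (k) => // j; rewrite leq_exp2r.
Qed.

Lemma bin_le (R : realType) (n k : nat) (x : R) : (0 < k)%N -> n%:R <= x ->
  'C(n, k)%:R <= (3 * x / k%:R) ^+ k.
Proof.
move=> k0 nx; have x0 : 0 <= x by apply: le_trans nx.
have kR : 0 < k%:R :> R by rewrite ltr0n.
rewrite exprMn exprVn ler_pdivlMr ?exprn_gt0 //.
apply: (@le_trans _ _ ('C(n, k)%:R * (3 ^+ k * k`!%:R))).
  by apply: ler_wpM2l; rewrite ?expnn_le_fact.
rewrite mulrCA exprMn; apply: ler_wpM2l; first by rewrite exprn_ge0.
rewrite -natrM; apply: (@le_trans _ _ ((n ^ k)%:R)); first by rewrite ler_nat bin_le_expn.
by rewrite natrX; apply: lerXn2r; rewrite ?nnegrE.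
Qed.

Lemma sum_half_le1 (R : realType) (n : nat) :
  \sum_(i < n.+1 | (0 < i)%N) (2^-1 : R) ^+ i <= 1.
Proof.
suff -> : \sum_(i < n.+1 | (0 < i)%N) (2^-1 : R) ^+ i = 1 - 2^-1 ^+ n.
  by rewrite lerBlDr lerDl exprn_ge0 ?invr_ge0.
rewrite big_mkcond; elim: n => [|n IHn]; first by rewrite big_ord1 expr0 subrr.
by rewrite big_ord_recr /= IHn exprS; lra.
Qed.

Section Dense.
Variables (R : realType) (n : nat) (p : R).
Hypothesis p01 : 0 <= p <= 1.

Definition dense_at (s m : nat) (G : graph 'I_n) : bool :=
  [exists S : {set 'I_n}, (#|S| == s) && (m <= #|edges_in G S|)%N].

Lemma card_edge_subset (V : finType) (S : {set V}) :
  (#|[set e : edge V | val e \subset S]| <= 'C(#|S|, 2))%N.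
Proof.
rewrite -cards_draws -(card_imset _ val_inj); apply/subset_leq_card/subsetP => A.
by case/imsetP=> e; rewrite !inE => eS ->; rewrite eS (valP e).
Qed.

Lemma dense_at_le (s m : nat) :
  Gnp_prob p (dense_at s m) <= 'C(n, s)%:R * ('C('C(s, 2), m)%:R * p ^+ m).
Proof.
have /andP[p0 _] := p01.
pose Q (i : {set 'I_n} * {set edge 'I_n}) :=
  (#|i.1| == s) && ((i.2 \subset [set e : edge 'I_n | val e \subset i.1]) && (#|i.2| == m)).
apply: (@le_trans _ _ (\sum_(i | Q i) p ^+ #|i.2|)).
  rewrite -(eq_bigr _ (fun i _ => Gnp_prob_sub p i.2)); apply: Gnp_prob_exists => // G.
  case/existsP=> S /andP[cS leE]; have [F sFE cF] := sub_card_exists leE.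
  exists (S, F); rewrite /Q /= ?cS ?cF ?eqxx ?andbT /=.
    by apply: subset_trans sFE _; apply/subsetP => e; rewrite !inE => /andP[].
  by apply: subset_trans sFE _; apply/subsetP => e; rewrite inE => /andP[].
rewrite -(pair_big_dep (fun S : {set 'I_n} => #|S| == s)
  (fun S (F : {set edge 'I_n}) => (F \subset [set e : edge 'I_n | val e \subset S]) && (#|F| == m))
  (fun _ (F : {set edge 'I_n}) => p ^+ #|F|)) /=.
apply: (@le_trans _ _ (\sum_(S : {set 'I_n} | #|S| == s) ('C('C(s, 2), m)%:R * p ^+ m))).
  apply: ler_sum => S /eqP cS.
  rewrite (eq_bigr (fun=> p ^+ m)); last by move=> F /andP[_ /eqP->].
  rewrite sumr_const -[leLHS]mulr_natl; apply: ler_wpM2r; first exact: exprn_ge0.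
  rewrite ler_nat -cS; apply: (@leq_trans 'C(#|[set e : edge 'I_n | val e \subset S]|, m)).
    by rewrite -cards_draws; apply/eq_leq/eq_card => F; rewrite !inE.
  by apply: leq_bin2l; apply: card_edge_subset.
rewrite sumr_const -[leLHS]mulr_natl; apply: ler_wpM2r.
  by rewrite mulr_ge0 // exprn_ge0.
rewrite ler_nat -[n in 'C(n, s)]card_ord -card_draws.
by apply/eq_leq/eq_card => S; rewrite !inE.
Qed.

Variable d : nat.
Hypotheses (d0 : (0 < d)%N) (n0 : (0 < n)%N) (p_le : p <= d%:R / n%:R).

Lemma dense_at_prob (s m : nat) : (0 < s)%N -> (0 < m)%N ->
  Gnp_prob p (dense_at s m) <=
    (3 * n%:R / s%:R) ^+ s * (3 * s%:R ^+ 2 * d%:R / (2 * m%:R * n%:R)) ^+ m.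
Proof.
move=> s0 m0; have /andP[p0 _] := p01.
have [sR mR nR] : [/\ 0 < s%:R :> R, 0 < m%:R :> R & 0 < n%:R :> R] by rewrite !ltr0n.
apply: le_trans (dense_at_le s m) _; apply: ler_pM => //.
- by rewrite mulr_ge0 // exprn_ge0.
- exact: bin_le.
have -> : 3 * s%:R ^+ 2 * d%:R / (2 * m%:R * n%:R) =
    (3 * (s%:R ^+ 2 / 2) / m%:R) * (d%:R / n%:R) :> R by field; lra.
rewrite [leRHS]exprMn; apply: ler_pM; rewrite ?exprn_ge0 //.
  apply: bin_le => //; rewrite ler_pdivlMr // -natrM -natrX ler_nat.
  by rewrite bin2 -{2}[s]/(s) -divn2; have := leq_divM (s * s.-1) 2; nia.
by apply: lerXn2r; rewrite ?nnegrE // divr_ge0.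
Qed.

Lemma pow4_le_pow2 (s : nat) : s%:R * (4^-1 : R) ^+ s <= 2^-1 ^+ s.
Proof.
have -> : (4^-1 : R) = 2^-1 * 2^-1 by lra.
rewrite exprMn mulrA ler_piMl ?exprn_ge0 ?invr_ge0 // exprVn.
by rewrite ler_pdivrMr ?exprn_gt0 // mul1r -natrX ler_nat ltnW // ltn_expl.
Qed.

Lemma dense_linear_prob (s : nat) : (0 < s <= n)%N ->
  Gnp_prob p (dense_at s (8 * d * s)) <= 2^-1 ^+ s / n%:R.
Proof.
case/andP=> s0 sn.
have [dR sR nR] : [/\ 0 < d%:R :> R, 0 < s%:R :> R & 0 < n%:R :> R] by rewrite !ltr0n.
have m0 : (0 < 8 * d * s)%N by rewrite !muln_gt0 d0.
apply: le_trans (dense_at_prob s0 m0) _.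
pose x : R := s%:R / n%:R.
have x0 : 0 < x by rewrite divr_gt0.
have x1 : x <= 1 by rewrite ler_pdivrMr // mul1r ler_nat.
have -> : 3 * s%:R ^+ 2 * d%:R / (2 * (8 * d * s)%:R * n%:R) = 3 * x / 16 :> R.
  by rewrite /x !natrM; field; rewrite !gt_eqF.
have -> : 3 * n%:R / s%:R = 3 / x :> R by rewrite /x; field; rewrite !gt_eqF.
apply: (@le_trans _ _ ((3 / x) ^+ s * ((3 * x / 16) ^+ 2) ^+ s)).
  apply: ler_wpM2l; first by rewrite exprn_ge0 // divr_ge0 // ltW.
  rewrite -exprM; apply: ler_wiXn2l; [lra|lra|].
  by rewrite leq_mul2r -{1}[2%N]muln1 leq_mul ?orbT.
have -> : (3 / x) ^+ s * ((3 * x / 16) ^+ 2) ^+ s = (27 / 256 * x) ^+ s.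
  by rewrite -exprMn; congr (_ ^+ _); field; rewrite gt_eqF.
apply: (@le_trans _ _ ((4^-1 * x) ^+ s)).
  by apply: lerXn2r; rewrite ?nnegrE; lra.
rewrite exprMn; apply: (@le_trans _ _ (4^-1 ^+ s * x)).
  apply: ler_wpM2l; first by rewrite exprn_ge0 ?invr_ge0.
  by case: (s) s0 => // k _; rewrite exprS ler_piMr ?(ltW x0) // exprn_ile1 // ltW.
by rewrite /x mulrA ler_pM2r ?invr_gt0 // mulrC pow4_le_pow2.
Qed.

Lemma dense_small_prob (b : nat) : (0 < b)%N -> (256 * d ^ 3 * b <= n)%N ->
  Gnp_prob p (dense_at (4 * b) (6 * b)) <= 36 * d%:R ^+ 3 * (2^-1 ^+ b / n%:R).
Proof.
move=> b0 bn.
have [dR bR nR] : [/\ 0 < d%:R :> R, 0 < b%:R :> R & 0 < n%:R :> R] by rewrite !ltr0n.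
have s0 : (0 < 4 * b)%N by rewrite muln_gt0.
have m0 : (0 < 6 * b)%N by rewrite muln_gt0.
apply: le_trans (dense_at_prob s0 m0) _.
pose x : R := b%:R / n%:R; pose y : R := 36 * d%:R ^+ 3 * x.
have x0 : 0 < x by rewrite divr_gt0.
have y0 : 0 < y by rewrite /y; apply: mulr_gt0 => //; apply: mulr_gt0 => //; apply: exprn_gt0.
have y4 : y <= 4^-1.
  have : 256 * d%:R ^+ 3 * b%:R <= n%:R :> R by rewrite -natrX -!natrM ler_nat.
  move=> le1; rewrite -(@ler_pM2r _ n%:R) //.
  have -> : y * n%:R = 36 * d%:R ^+ 3 * b%:R by rewrite /y /x; field; rewrite gt_eqF.
  by lra.
have -> : 3 * (4 * b)%:R ^+ 2 * d%:R / (2 * (6 * b)%:R * n%:R) = 4 * d%:R * x :> R.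
  by rewrite /x !natrM; field; rewrite !gt_eqF.
have -> : 3 * n%:R / (4 * b)%:R = 3 / (4 * x) :> R.
  by rewrite /x natrM; field; rewrite !gt_eqF.
have -> : (3 / (4 * x)) ^+ (4 * b) * (4 * d%:R * x) ^+ (6 * b) = (y ^+ 2) ^+ b.
  by rewrite !exprM -exprMn; congr (_ ^+ _); rewrite /y; field; rewrite gt_eqF.
rewrite -exprM; apply: (@le_trans _ _ (y * 4^-1 ^+ b)).
  have -> : (2 * b = (2 * b - 1).+1)%N by lia.
  rewrite exprS ler_pM2l //; apply: (@le_trans _ _ (4^-1 ^+ (2 * b - 1))).
    by apply: lerXn2r; rewrite ?nnegrE ?(ltW y0) ?invr_ge0.
  by apply: ler_wiXn2l; [lra|lra|lia].
have := pow4_le_pow2 b; rewrite /y /x => le2.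
have -> : 36 * d%:R ^+ 3 * (b%:R / n%:R) * 4^-1 ^+ b =
  36 * d%:R ^+ 3 * (b%:R * 4^-1 ^+ b / n%:R) :> R by field; rewrite gt_eqF.
by rewrite ler_pM2l ?mulr_gt0 ?exprn_gt0 // ler_pM2r ?invr_gt0.
Qed.

Definition sparse_graph (G : graph 'I_n) : bool :=
  [forall S : {set 'I_n}, (S != set0) ==> (#|edges_in G S| < 8 * d * #|S|)%N] &&
  [forall b : 'I_n.+1, forall S : {set 'I_n},
    [&& (0 < b)%N, (256 * d ^ 3 * b <= n)%N & #|S| == (4 * b)%N] ==>
    (#|edges_in G S| < 6 * b)%N].

Lemma sparse_graph_prob :
  Gnp_prob p (fun G => ~~ sparse_graph G) <= (1 + 36 * d%:R ^+ 3) / n%:R.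
Proof.
have nR : 0 < n%:R :> R by rewrite ltr0n.
pose B1 (G : graph 'I_n) :=
  ~~ [forall S : {set 'I_n}, (S != set0) ==> (#|edges_in G S| < 8 * d * #|S|)%N].
pose B2 (G : graph 'I_n) := ~~ [forall b : 'I_n.+1, forall S : {set 'I_n},
    [&& (0 < b)%N, (256 * d ^ 3 * b <= n)%N & #|S| == (4 * b)%N] ==>
    (#|edges_in G S| < 6 * b)%N].
apply: le_trans (@Gnp_prob_or _ _ _ p01 _ B1 B2 _) _.
  by move=> G; rewrite /sparse_graph negb_and.
rewrite mulrDl; apply: lerD.
  apply: (@le_trans _ _ (\sum_(s < n.+1 | (0 < s)%N) Gnp_prob p (dense_at s (8 * d * s)))).
    apply: Gnp_prob_exists => // G; case/forallPn=> S; rewrite negb_imply -leqNgt.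
    case/andP=> S0 leE; have ltS : (#|S| < n.+1)%N by rewrite ltnS -[leqRHS]card_ord max_card.
    exists (Ordinal ltS); rewrite /= ?card_gt0 //.
    by apply/existsP; exists S; rewrite eqxx.
  apply: (@le_trans _ _ (\sum_(s < n.+1 | (0 < s)%N) 2^-1 ^+ s / n%:R)).
    by apply: ler_sum => s s0; apply: dense_linear_prob; rewrite s0 -ltnS ltn_ord.
  by rewrite -mulr_suml ler_pM2r ?invr_gt0 // sum_half_le1.
pose Q (b : 'I_n.+1) := (0 < b)%N && (256 * d ^ 3 * b <= n)%N.
apply: (@le_trans _ _ (\sum_(b | Q b) Gnp_prob p (dense_at (4 * b) (6 * b)))).
  apply: Gnp_prob_exists => // G; case/forallPn=> b; rewrite negb_forall.
  case/existsP=> S; rewrite negb_imply -leqNgt => /andP[/and3P[b0 bn cS] leE].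
  by exists b; rewrite /Q ?b0 //; apply/existsP; exists S; rewrite cS.
apply: (@le_trans _ _ (\sum_(b < n.+1 | (0 < b)%N) 36 * d%:R ^+ 3 * (2^-1 ^+ b / n%:R))).
  rewrite /Q big_mkcondr; apply: ler_sum => b b0; case: ifP => [bn|_].
    exact: dense_small_prob.
  by rewrite !mulr_ge0 ?invr_ge0 ?exprn_ge0 ?invr_ge0.
rewrite -mulr_sumr -mulr_suml mulrA ler_pM2r ?invr_gt0 //.
by rewrite ler_piMr ?sum_half_le1 // mulr_ge0 // exprn_ge0.
Qed.

End Dense.

Lemma sparse_graph_arranged (n d : nat) (G : graph 'I_n) : (0 < d)%N -> sparse_graph d G ->
  arranged (adj G) (16 * d) (4 * (16 * d) * (256 * d ^ 3)).+1 [set: 'I_n].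
Proof.
move=> d0 /andP[/forallP sp1 /forallP sp2].
apply: sparse_arranged; rewrite ?muln_gt0 ?expn_gt0 ?d0 //; first exact: adjC.
  move=> S S0; have := sp1 S; rewrite S0 /= => ltE.
  apply: leq_ltn_trans (arcs_edges_in G S) _.
  by rewrite -[16%N]/(2 * 8)%N -!mulnA ltn_pmul2l // !mulnA.
move=> S b b0; rewrite card_ord => bn cS.
have ltb : (b < n.+1)%N by rewrite ltnS (leq_trans _ bn) // leq_pmull // muln_gt0 expn_gt0 d0.
have /forallP/(_ S) := sp2 (Ordinal ltb); rewrite /= b0 bn cS eqxx /= => ltE.
apply: leq_ltn_trans (arcs_edges_in G S) _.
by rewrite -[12%N]/(2 * 6)%N -!mulnA ltn_pmul2l.
Qed.

Lemma card_set_type (T : finType) : #|{set T}| = (2 ^ #|T|)%N.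
Proof. by have := card_powerset [set: T]; rewrite powersetT !cardsT. Qed.

Lemma adjI (V : finType) (P : pred {set V}) (x y : V) :
  x != y -> P [set x; y] -> adj [set e : edge V | P (val e)] x y.
Proof.
move=> xy Pxy; have [e ve] := edge_exists xy.
by apply/exists_inP; exists e; rewrite ?inE ve.
Qed.

Lemma arcsT_le (V : finType) (F : graph V) : (arcs (adj F) [set: V] <= 2 * #|F|)%N.
Proof.
apply: leq_trans (arcs_edges_in _ _) _; rewrite leq_mul2l /=.
by apply/subset_leq_card/subsetP => e; rewrite inE => /andP[].
Qed.

Lemma card_inner_edges (V : finType) (S : {set V}) :
  (#|S| * #|S|.-1 <= 2 * #|[set e : edge V | val e \subset S]|)%N.
Proof.
set F := [set e | _]; apply: leq_trans (arcsT_le F).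
rewrite /arcs (big_setID S) /= setTI; apply: leq_trans (leq_addr _ _).
rewrite -sum_nat_const; apply: leq_sum => x xS.
have -> : #|S|.-1 = #|S :\ x| by rewrite (cardsD1 x S) xS.
apply/subset_leq_card/subsetP => y; rewrite !inE eq_sym => /andP[yx yS].
by apply: (@adjI _ (fun A => A \subset S)) => //; rewrite subUset !sub1set xS.
Qed.

Lemma card_boundary_edges (V : finType) (T : {set V}) :
  (#|T| * (#|V| - #|T|) <= #|[set e : edge V | ~~ [disjoint val e & T]]|)%N.
Proof.
set F := [set e | _]; rewrite -(@leq_pmul2l 2) //; apply: leq_trans (arcsT_le F).
have touch x y : x \in T -> y \notin T -> adj F x y.
  move=> xT yT; apply: (@adjI _ (fun A => ~~ [disjoint A & T])); first by apply: contraNneq yT => <-.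
  by apply/pred0Pn; exists x; rewrite !inE eqxx.
have cT := cardsCs T; have cC : #|~: T| = (#|V| - #|T|)%N by rewrite cardsCs setCK.
rewrite /arcs (big_setID T) /= setTI setTD mul2n -addnn; apply: leq_add.
  rewrite -sum_nat_const; apply: leq_sum => x xT; rewrite -cC.
  by apply/subset_leq_card/subsetP => y; rewrite !inE => yT; apply: touch.
rewrite mulnC -cC -sum_nat_const; apply: leq_sum => x; rewrite inE => xT.
by apply/subset_leq_card/subsetP => y yT; rewrite !inE adjC touch.
Qed.

Lemma expn_le_ffact (t m : nat) : ((t - m) ^ m <= t ^_ m)%N.
Proof.
elim: m t => [|m IHm] t; first by rewrite ffactn0.
case: t => [|t]; first by rewrite sub0n exp0n.
rewrite ffactnS expnS subSS; apply: leq_mul; first by lia.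
exact: IHm.
Qed.

Lemma bin_ratio_le (n t m : nat) : ('C(n, m) * (t - m) ^ m <= 'C(t, m) * n ^ m)%N.
Proof.
rewrite -(@leq_pmul2r m`!) ?fact_gt0 // mulnAC.
apply: (@leq_trans (n ^ m * t ^_ m)); first by rewrite leq_mul ?bin_le_expn ?expn_le_ffact.
by rewrite -bin_ffact; lia.
Qed.

Section LowerEvents.
Variables (R : realType) (n : nat) (p : R).
Hypothesis p01 : 0 <= p <= 1.

Let p_le1 : p <= 1. Proof. by case/andP: p01. Qed.
Let q_ge0 : 0 <= 1 - p. Proof. by rewrite subr_ge0. Qed.
Let q_le1 : 1 - p <= 1. Proof. by rewrite lerBlDr lerDl; case/andP: p01. Qed.

Definition has_independent (s : nat) (G : graph 'I_n) : bool :=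
  [exists S : {set 'I_n}, (s <= #|S|)%N && [forall e in G, ~~ (val e \subset S)]].

Definition has_isolated (t : nat) (G : graph 'I_n) : bool :=
  [exists S : {set 'I_n}, (t <= #|S|)%N && [forall e in G, [disjoint val e & S]]].

Lemma expR_edges (k m : nat) : (k <= 2 * m)%N -> (1 - p) ^+ m <= expR (- (p * k%:R / 2)).
Proof.
move=> km; apply: le_trans (exp1B_le _ p_le1) _; rewrite ler_expR lerN2 -mulrA.
apply: ler_wpM2l; first by case/andP: p01.
by rewrite ler_pdivrMr // -natrM ler_nat mulnC.
Qed.

Lemma independent_prob (s : nat) :
  Gnp_prob p (has_independent s) <= 2 ^+ n * expR (- (p * (s * s.-1)%:R / 2)).
Proof.
apply: (@le_trans _ _ (\sum_(S : {set 'I_n} | (s <= #|S|)%N)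
    (1 - p) ^+ #|[set e : edge 'I_n | val e \subset S]|)).
  rewrite -(eq_bigr _ (fun S _ => Gnp_prob_disjoint p _)); apply: Gnp_prob_exists => // G.
  case/existsP=> S /andP[sS /forall_inP indS]; exists S => //=.
  by rewrite disjoint_subset; apply/subsetP => e eG; rewrite !inE indS.
apply: (@le_trans _ _ (\sum_(S : {set 'I_n}) expR (- (p * (s * s.-1)%:R / 2)))).
  rewrite big_mkcond; apply: ler_sum => S _; case: ifP => sS; last exact: expR_ge0.
  apply: expR_edges; apply: leq_trans (card_inner_edges S).
  by rewrite leq_mul // -!subn1 leq_sub2r.
by rewrite sumr_const -[leLHS]mulr_natl card_set_type card_ord natrX.
Qed.

(* A plain union bound over the sets of t vertices is too weak when d = 2; counting
   the m-subsets of the set of isolated vertices gains the factor ['C(t, m)]. *)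
Lemma isolated_prob (t m : nat) : (m < t)%N ->
  Gnp_prob p (has_isolated t) <= (n%:R / (t - m)%:R * expR (- (p * (n - m)%:R))) ^+ m.
Proof.
move=> mt; have tm0 : 0 < (t - m)%:R :> R by rewrite ltr0n subn_gt0.
have C0 : 0 < 'C(t, m)%:R :> R by rewrite ltr0n bin_gt0 ltnW.
pose F (T : {set 'I_n}) := [set e : edge 'I_n | ~~ [disjoint val e & T]].
have : 'C(t, m)%:R * Gnp_prob p (has_isolated t) <=
    \sum_(T : {set 'I_n} | #|T| == m) (1 - p) ^+ #|F T|.
  rewrite -(eq_bigr _ (fun T _ => Gnp_prob_disjoint p (F T))).
  apply: Gnp_prob_union => // G; case/existsP=> S /andP[tS /forall_inP isoS].
  apply: (@leq_trans #|[set T : {set 'I_n} | T \subset S & #|T| == m]|).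
    by rewrite cards_draws leq_bin2l.
  apply/subset_leq_card/subsetP => T; rewrite !inE => /andP[sTS ->] /=.
  rewrite disjoint_subset; apply/subsetP => e /isoS dS; rewrite !inE negbK.
  exact: disjointWr sTS dS.
have leF : \sum_(T : {set 'I_n} | #|T| == m) (1 - p) ^+ #|F T| <=
    'C(n, m)%:R * expR (- (p * (n - m)%:R)) ^+ m.
  apply: (@le_trans _ _ (\sum_(T : {set 'I_n} | #|T| == m) expR (- (p * (n - m)%:R)) ^+ m)).
    apply: ler_sum => T /eqP cT; have := card_boundary_edges T; rewrite card_ord cT -/(F T) => leFT.
    apply: (@le_trans _ _ ((1 - p) ^+ (m * (n - m)))); first exact: ler_wiXn2l.
    apply: le_trans (exp1B_le _ p_le1) _; rewrite -expRM_natr natrM.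
    by rewrite ler_expR; lra.
  rewrite sumr_const -[leLHS]mulr_natl; apply: ler_wpM2r; first by rewrite exprn_ge0 ?expR_ge0.
  rewrite ler_nat -[n in 'C(n, m)]card_ord -card_draws.
  by apply/eq_leq/eq_card => T; rewrite !inE.
move=> /le_trans/(_ leF) le1; rewrite -(ler_pM2l C0); apply: le_trans le1 _.
rewrite exprMn mulrA; apply: ler_wpM2r; first by rewrite exprn_ge0 ?expR_ge0.
rewrite exprMn exprVn mulrA ler_pdivlMr ?exprn_gt0 // -!natrX -!natrM ler_nat.
exact: bin_ratio_le.
Qed.

Definition has_balanced_map (j w : nat) (G : graph 'I_n) : bool :=
  [exists b : bool, exists g : {ffun 'I_n -> {set 'I_(j.*2)}},
    [forall X, (#|[set x | g x == X]| <= w)%N] &&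
    [disjoint G & offending (@odd_meet _) g b]].

Lemma balanced_map_prob (j w : nat) : (3 * 2 ^ j * w <= n)%N ->
  Gnp_prob p (has_balanced_map j w) <=
    2 * (4 ^+ j) ^+ n * expR (- (p * (n%:R ^+ 2 - 3 * n%:R) / 6)).
Proof.
move=> jw; set E := expR _.
pose Q (i : bool * {ffun 'I_n -> {set 'I_(j.*2)}}) :=
  [forall X, (#|[set x | i.2 x == X]| <= w)%N].
apply: (@le_trans _ _ (\sum_(i | Q i) (1 - p) ^+ #|offending (@odd_meet _) i.2 i.1|)).
  rewrite -(eq_bigr _ (fun i _ => Gnp_prob_disjoint p (offending (@odd_meet _) i.2 i.1))).
  apply: Gnp_prob_exists => // G; case/existsP=> b /existsP[g /andP[leg disg]].
  by exists (b, g).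
apply: (@le_trans _ _ (\sum_(i : bool * {ffun 'I_n -> {set 'I_(j.*2)}}) E)).
  rewrite big_mkcond; apply: ler_sum => i _; case: ifP => Qi; last exact: expR_ge0.
  apply: le_trans (exp1B_le _ p_le1) _; rewrite ler_expR lerN2.
  have := @card_offending _ _ i.2 j w i.1 erefl (fun X => forallP Qi X).
  rewrite card_ord => /(_ jw) le6N.
  have le6 : n%:R ^+ 2 <= 6 * #|offending (@odd_meet _) i.2 i.1|%:R + 3 * n%:R :> R.
    by rewrite -natrX -!natrM -natrD ler_nat.
  rewrite -mulrA; apply: ler_wpM2l; first by case/andP: p01.
  by rewrite ler_pdivrMr // ; lra.
rewrite sumr_const -[leLHS]mulr_natl; apply: ler_wpM2r; first exact: expR_ge0.
rewrite card_prod card_bool card_ffun card_set_type !card_ord natrM !natrX.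
by rewrite -muln2 mulnC exprM -natrX.
Qed.

End LowerEvents.

Lemma ramsey_gt_small (n a b : nat) (G : graph 'I_n) :
  ~~ has_independent (n - a) G -> ~~ has_isolated (n - b) G -> (a + b < ramsey G)%N.
Proof.
move=> nind niso; rewrite ltnNge; apply/negP => le_ab.
have [[S]|[S]] := arrows_split le_ab (arrows_ramsey G); rewrite card_ord => cS GS.
  case/negP: nind; apply/existsP; exists S; rewrite leq_subLR addnC cS.
  exact/forall_inP.
case/negP: niso; apply/existsP; exists S; rewrite leq_subLR addnC cS.
exact/forall_inP.
Qed.

Lemma ramsey_gt_large (n j w : nat) (G : graph 'I_n) :
  ~~ has_balanced_map j w G -> (4 ^ j * w < ramsey G)%N.
Proof.
move=> nbal; rewrite ltnNge; apply/negP => le_r.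
have [|part lew] := @balanced_parts {set 'I_(j.*2)} (ramsey G) w.
  by rewrite card_set_type card_ord -mul2n expnM.
have [b [g [disg leg]]] := arrows_parts part (@odd_meetC _) (arrows_ramsey G).
case/negP: nbal; apply/existsP; exists b; apply/existsP; exists g; rewrite disg andbT.
by apply/forallP => X; apply: leq_trans (leg X) (lew X).
Qed.

(** * Numerical estimates *)

Lemma ramsey_sparse_le (n L : nat) (G : graph 'I_n) :
  (0 < n)%N -> (0 < L)%N -> sparse_graph (2 ^ L) G ->
  (ramsey G <= 2 ^ (1629 * L ^ 2 * 2 ^ L) * n)%N.
Proof.
move=> n0 L0 spG.
have dL : (0 < 2 ^ L)%N by rewrite expn_gt0.
have := sparse_graph_arranged dL spG.
rewrite (_ : 16 * 2 ^ L = 2 ^ (L + 4))%N; last by rewrite expnD mulnC.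
pose M := (4 * 2 ^ (L + 4) * (256 * (2 ^ L) ^ 3)).+1; rewrite -/M => arrG.
have V0 : (0 < #|'I_n|)%N by rewrite card_ord.
have := arrows_arranged V0 arrG; rewrite card_ord => arr.
apply: leq_trans (ramsey_le _ arr) _.
  by rewrite muln_gt0 n0 andbT expn_gt0 muln_gt0 expn_gt0 /= ?addn1.
rewrite leq_mul2r; apply/orP; right.
have leM : (4 * M + 1 <= 2 ^ (4 * L + 17))%N.
  have -> : (2 ^ (4 * L + 17) = 2 ^ 3 * (2 ^ 2 * 2 ^ (L + 4) * (2 ^ 8 * (2 ^ L) ^ 3)))%N.
    by rewrite -expnM -!expnD; congr (2 ^ _)%N; lia.
  have : (0 < 2 ^ (L + 4) * (2 ^ L) ^ 3)%N by rewrite muln_gt0 !expn_gt0.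
  by rewrite /M; lia.
apply: (@leq_trans (2 ^ (((L + 4 + 5) * 2 ^ (L + 4) + (4 * L + 17)) * (L + 4 + 4)))).
  rewrite [leqRHS]expnM [(2 ^ (_ * _ + _))%N]expnD leq_exp2r ?leq_mul2l ?leM ?orbT //.
  by rewrite addnS.
rewrite leq_exp2l //.
have lt2 : (L <= 2 ^ L)%N by rewrite ltnW // ltn_expl.
have two : (2 <= 2 ^ L)%N by rewrite -{1}[2%N]expn1 leq_exp2l.
rewrite expnD -[(2 ^ 4)%N]/16%N.
apply: (@leq_trans ((10 * L * (2 ^ L * 16) + 21 * L) * (9 * L))).
  by apply: leq_mul; [apply: leq_add; [apply: leq_mul; lia | lia] | lia].
apply: (@leq_trans ((10 * L * (2 ^ L * 16) + 21 * (L * 2 ^ L)) * (9 * L))).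
  by rewrite leq_mul2r leq_add2l leq_mul2l leq_pmulr ?orbT.
rewrite [(L ^ 2)%N]expnS expn1; lia.
Qed.

Section Estimates.
Variable R : realType.
Implicit Types (d x : R).

Lemma bernoulli x (k : nat) : 0 <= x -> 1 + k%:R * x <= (1 + x) ^+ k.
Proof.
move=> x0; elim: k => [|k IHk]; first by rewrite mul0r addr0 expr0.
have k0 : 0 <= k%:R * x by rewrite mulr_ge0.
rewrite exprS; apply: (@le_trans _ _ ((1 + x) * (1 + k%:R * x))).
  have : 0 <= x * (k%:R * x) by rewrite mulr_ge0.
  by rewrite -natr1; lra.
by apply: ler_wpM2l => //; lra.
Qed.

Lemma geometric_le x y (k : nat) : 0 <= y -> 0 < x -> y * (1 + x) <= 1 ->
  y ^+ k <= (1 + k%:R * x)^-1.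
Proof.
move=> y0 x0 yx; have k0 : 0 < 1 + k%:R * x by rewrite ltr_pwDl // mulr_ge0 // ltW.
rewrite -div1r ler_pdivlMr //; apply: (@le_trans _ _ (y ^+ k * (1 + x) ^+ k)).
  by rewrite ler_wpM2l ?exprn_ge0 // bernoulli // ltW.
by rewrite -exprMn exprn_ile1 // mulr_ge0 // addr_ge0 // ltW.
Qed.

Lemma expR_ge_pow x (k : nat) : 0 <= x -> (1 + x / k.+1%:R) ^+ k.+1 <= expR x.
Proof.
move=> x0; rewrite -{2}[x](@divfK _ k.+1%:R) ?pnatr_eq0 // expRM_natr.
have xk : 0 <= x / k.+1%:R by rewrite divr_ge0.
by apply: lerXn2r; rewrite ?nnegrE ?expR_ge0 ?expR_ge1Dx // addr_ge0.
Qed.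

Lemma log2_bounds d : 2 <= d -> exists L : nat,
  [/\ (0 < L)%N, d <= (2 ^ L)%:R &
      (1629 * L ^ 2 * 2 ^ L)%:R <= 13032 * d * log2 d ^+ 2].
Proof.
move=> d2; have d0 : 0 < d by lra.
pose L := (Num.truncn (log2 d)).+1; exists L.
have l2 : 0 < ln 2 :> R by rewrite ln_gt0 //; lra.
have log1 : 1 <= log2 d by rewrite /log2 ler_pdivlMr // mul1r ler_ln ?posrE.
have log0 : 0 <= log2 d by lra.
have /andP[le_trunc lt_trunc] := truncn_itv log0.
have two (k : nat) : (2 ^ k)%:R = expR (k%:R * ln 2) :> R.
  by rewrite natrX mulrC expRM_natr lnK ?posrE.
have dE : d = expR (log2 d * ln 2) by rewrite /log2 divfK ?gt_eqF // lnK ?posrE.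
have leL : L%:R <= 2 * log2 d by rewrite /L -natr1; lra.
have le2L : (2 ^ L)%:R <= 2 * d.
  have -> : 2 * d = expR ((log2 d + 1) * ln 2).
    by rewrite (mulrDl (log2 d)) mul1r expRD -dE lnK ?posrE // mulrC.
  by rewrite two ler_expR ler_pM2r // /L -natr1; lra.
split=> //; first by rewrite two dE ler_expR ler_pM2r // ltW.
rewrite !natrM natrX; have L0 : 0 <= L%:R :> R by [].
apply: (@le_trans _ _ (1629 * (2 * log2 d) ^+ 2 * (2 * d))); last by lra.
apply: ler_pM; rewrite ?mulr_ge0 ?exprn_ge0 -?natrX //.
rewrite ler_pM2l // -expr2; apply: lerXn2r; rewrite ?nnegrE //.
by apply: mulr_ge0.
Qed.

Section Small.
Variables (n : nat) (d : R).
Hypotheses (n1 : (1 < n)%N) (d2 : 2 <= d) (p1 : d / n%:R <= 1).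

Let nR : 0 < n%:R :> R. Proof. by rewrite ltr0n ltnW. Qed.
Let p01 : 0 <= d / n%:R <= 1.
Proof. by rewrite p1 andbT divr_ge0 // (le_trans _ d2). Qed.
Let p2 : 2 / n%:R <= d / n%:R. Proof. by rewrite ler_pM2r ?invr_gt0. Qed.

Lemma independent_tail :
  Gnp_prob (d / n%:R) (@has_independent n (n - 4 * n %/ 25)) <= 750 / n%:R.
Proof.
set s := (n - _)%N; apply: le_trans (independent_prob _ p01 s) _.
have sn : (21 * n <= 25 * s)%N by rewrite /s; have := leq_divM (4 * n) 25; lia.
have {}sn : 21 / 25 * n%:R <= s%:R :> R.
  have : (21 * n)%:R <= (25 * s)%:R :> R by rewrite ler_nat.
  by rewrite !natrM; lra.
have n2 : 2 <= n%:R :> R by rewrite ler_nat.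
have s1 : s%:R - 1 <= s.-1%:R :> R by rewrite lerBlDr natr1 ler_nat leqSpred.
have lower : 441 / 625 * n%:R - 21 / 25 <= d / n%:R * (s * s.-1)%:R / 2.
  apply: (@le_trans _ _ (2 / n%:R * (21 / 25 * n%:R * (21 / 25 * n%:R - 1)) / 2)).
    by rewrite le_eqVlt; apply/orP; left; apply/eqP; field; rewrite gt_eqF.
  rewrite ler_pM2r ?invr_gt0 //; apply: ler_pM => //.
  - by rewrite divr_ge0 // ltW.
  - by apply: mulr_ge0; lra.
  - by rewrite natrM; apply: ler_pM => //; lra.
apply: (@le_trans _ _ (2 ^+ n * expR (21 / 25 - 441 / 625 * n%:R))).
  by rewrite ler_wpM2l ?exprn_ge0 // ler_expR; lra.
rewrite expRD -mulNr expRM_natr mulrCA -exprMn.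
have e3 : expR (21 / 25) <= 3 :> R.
  by apply: le_trans (expR1_le3 R); rewrite ler_expR; lra.
have base : 2 * expR (- (441 / 625)) * (1 + 1 / 250) <= 1 :> R.
  have := @expR_ge_pow (441 / 625) 31; rewrite expRN => /(_ ltac:(lra)) le1.
  have e0 := expR_gt0 (441 / 625 : R).
  rewrite mulrAC -ler_pdivlMr ?invr_gt0 // [leRHS]mul1r invrK.
  by apply: (le_trans _ le1); lra.
have y0 : 0 <= 2 * expR (- (441 / 625)) :> R by rewrite mulr_ge0 ?expR_ge0.
have le1 := @geometric_le (1 / 250) _ n y0 ltac:(lra) base.
apply: (@le_trans _ _ (3 * (1 + n%:R * (1 / 250))^-1)).
  by apply: ler_pM; rewrite ?expR_ge0 ?exprn_ge0.
rewrite -[750 / _]/(750 * _) -[leRHS]invrK invfM invrK -[leLHS]invrK invfM invrK.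
rewrite lef_pV2 ?posrE; [lra | |]; by apply: mulr_gt0 => //; lra.
Qed.

Lemma isolated_tail : (200 <= n)%N ->
  Gnp_prob (d / n%:R) (@has_isolated n (n - 169 * n %/ 200)) <= 10000 / n%:R.
Proof.
move=> n200; set t := (n - _)%N; pose m := (n %/ 100)%N.
have tn : (31 * n <= 200 * t)%N by rewrite /t; have := leq_divM (169 * n) 200; lia.
have mn : (100 * m <= n)%N by rewrite mulnC leq_divM.
have nm : (n < 100 * m + 100)%N by rewrite -mulnSr mulnC ltn_ceil.
have mt : (m < t)%N by lia.
have tmN : (29 * n <= 200 * (t - m))%N by lia.
have nmN : (99 * n <= 100 * (n - m))%N by lia.
apply: le_trans (isolated_prob _ p01 mt) _.
have tm0 : 0 < (t - m)%:R :> R by rewrite ltr0n subn_gt0.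
have tm : 29 / 200 * n%:R <= (t - m)%:R :> R.
  have : (29 * n)%:R <= (200 * (t - m))%:R :> R by rewrite ler_nat.
  by rewrite !natrM; lra.
have nmR : 99 / 100 * n%:R <= (n - m)%:R :> R.
  have : (99 * n)%:R <= (100 * (n - m))%:R :> R by rewrite ler_nat.
  by rewrite !natrM; lra.
have mR : n%:R / 100 - 1 <= m%:R :> R.
  have : n%:R <= (100 * m + 100)%:R :> R by rewrite ler_nat ltnW.
  by rewrite natrD natrM; lra.
have base : n%:R / (t - m)%:R * expR (- (d / n%:R * (n - m)%:R)) * (1 + 1 / 100) <= 1.
  apply: (@le_trans _ _ (200 / 29 * expR (- (99 / 50)) * (1 + 1 / 100))).
    rewrite ler_pM2r; last by lra.
    apply: ler_pM; rewrite ?expR_ge0 ?divr_ge0 //.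
      by rewrite ler_pdivrMr //; lra.
    rewrite ler_expR lerN2; apply: (@le_trans _ _ (2 / n%:R * (99 / 100 * n%:R))).
      by rewrite le_eqVlt; apply/orP; left; apply/eqP; field; rewrite gt_eqF.
    by apply: ler_pM => //; rewrite ?divr_ge0 ?mulr_ge0 //; lra.
  have := @expR_ge_pow (99 / 50) 63; rewrite expRN => /(_ ltac:(lra)) le1.
  have e0 := expR_gt0 (99 / 50 : R).
  rewrite mulrAC -ler_pdivlMr ?invr_gt0 // [leRHS]mul1r invrK.
  by apply: (le_trans _ le1); lra.
have y0 : 0 <= n%:R / (t - m)%:R * expR (- (d / n%:R * (n - m)%:R)).
  by rewrite mulr_ge0 ?expR_ge0 // divr_ge0.
apply: le_trans (geometric_le m y0 _ base) _; first by lra.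
rewrite -[leRHS]invrK invfM invrK lef_pV2 ?posrE; first by lra.
  by have : 0 <= m%:R :> R by []; lra.
by rewrite mulr_gt0 ?invr_gt0.
Qed.

End Small.

Lemma balanced_map_tail (n j : nat) d : (0 < n)%N -> 1 <= d -> d / n%:R <= 1 ->
  j%:R <= d / 24 ->
  Gnp_prob (d / n%:R) (@has_balanced_map n j (n %/ (3 * 2 ^ j))) <=
    24 * expR (d / 2) / n%:R.
Proof.
move=> n0 d1 p1 jd; have nR : 0 < n%:R :> R by rewrite ltr0n.
have p01 : 0 <= d / n%:R <= 1 by rewrite p1 andbT divr_ge0 //; lra.
have jw : (3 * 2 ^ j * (n %/ (3 * 2 ^ j)) <= n)%N by rewrite mulnC leq_divM.
apply: le_trans (balanced_map_prob p01 jw) _.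
have four : 4 <= expR 2 :> R.
  have -> : expR 2 = expR 1 * expR 1 :> R by rewrite -expRD.
  by have := expR_ge1Dx (1 : R); move: (expR 1) => e e2; nra.
have le1 : (4 ^+ j) ^+ n <= expR (d * n%:R / 12) :> R.
  rewrite -exprM; apply: (@le_trans _ _ (expR 2 ^+ (j * n))).
    by apply: lerXn2r; rewrite ?nnegrE ?expR_ge0.
  rewrite -expRM_natr ler_expR natrM.
  have : j%:R * n%:R <= d / 24 * n%:R by rewrite ler_pM2r.
  lra.
have -> : d / n%:R * (n%:R ^+ 2 - 3 * n%:R) / 6 = d * n%:R / 6 - d / 2.
  by field; rewrite gt_eqF.
apply: (@le_trans _ _ (2 * expR (d * n%:R / 12) * expR (- (d * n%:R / 6 - d / 2)))).
  by rewrite ler_pM2r ?expR_gt0 // ler_pM2l.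
rewrite -mulrA -expRD.
have -> : d * n%:R / 12 - (d * n%:R / 6 - d / 2) = d / 2 + - (d * n%:R / 12) by lra.
have tail : expR (- (d * n%:R / 12)) <= 12 / n%:R.
  rewrite expRN -[leRHS]invrK invf_div lef_pV2 ?posrE ?expR_gt0 ?divr_gt0 //.
  apply: le_trans (expR_ge1Dx _).
  have : n%:R <= d * n%:R by rewrite ler_peMl // ltW.
  lra.
have -> : 24 * expR (d / 2) / n%:R = 2 * (expR (d / 2) * (12 / n%:R)).
  by field; rewrite gt_eqF.
by rewrite expRD ler_pM2l // ler_pM2l ?expR_gt0.
Qed.

Lemma two_powR_inv (k : nat) : (0 < k)%N -> 2 `^ k%:R^-1 <= 1 + k%:R^-1 :> R.
Proof.
move=> k0; have kR : 0 < k%:R :> R by rewrite ltr0n.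
have base0 : 0 <= 1 + k%:R^-1 :> R by rewrite addr_ge0 // invr_ge0 ltW.
have le2 : 2 <= (1 + k%:R^-1) ^+ k :> R.
  have := @bernoulli k%:R^-1 k; rewrite mulfV ?gt_eqF // invr_ge0 => /(_ (ltW kR)).
  by rewrite -natr1.
apply: (@le_trans _ _ (((1 + k%:R^-1) ^+ k) `^ k%:R^-1)).
  by apply: ge0_ler_powR; rewrite ?nnegrE ?invr_ge0 ?exprn_ge0 // ltW.
by rewrite -powR_mulrn // -powRrM mulfV ?gt_eqF // powRr1.
Qed.

Lemma two_powR_small d : d <= 144 -> 2 `^ ((144 * 250)^-1 * d) <= 251 / 250 :> R.
Proof.
move=> d144; apply: (@le_trans _ _ (2 `^ (250%:R^-1))).
  by apply: ler_powR; lra.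
by apply: le_trans (two_powR_inv _) _ => //; lra.
Qed.

Lemma two_powR_large d : 144 <= d -> 4 * 2 `^ ((144 * 250)^-1 * d) <= 2 ^+ Num.truncn (d / 24) :> R.
Proof.
move=> d144; have d0 : 0 <= d / 24 by lra.
have /andP[_ lt_trunc] := truncn_itv d0.
have -> : 4 = 2 `^ 2%:R :> R by rewrite powR_mulrn //; lra.
rewrite -powRD; last by rewrite pnatr_eq0 implybT.
rewrite -powR_mulrn //; apply: ler_powR; first by lra.
have lt2 : d / 24 < (Num.truncn (d / 24))%:R + 1 by rewrite natr1.
move: ((Num.truncn (d / 24))%:R : R) lt2 => t lt2. lra.
Qed.

Lemma lower_small (n r : nat) d : d <= 144 -> (2000 <= n)%N ->
  (4 * n %/ 25 + 169 * n %/ 200 < r)%N -> 2 `^ ((144 * 250)^-1 * d) * n%:R <= r%:R :> R.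
Proof.
move=> d144 n2000 ltr; have nR : 0 <= n%:R :> R by [].
apply: (@le_trans _ _ (251 / 250 * n%:R)).
  by rewrite ler_wpM2r ?two_powR_small.
have : (251 * n)%:R <= (250 * r)%:R :> R.
  rewrite ler_nat; have := ltn_ceil (4 * n) (isT : 0 < 25)%N.
  by have := ltn_ceil (169 * n) (isT : 0 < 200)%N; lia.
by rewrite !natrM; lra.
Qed.

Lemma lower_large (n r : nat) d : 144 <= d ->
  let j := Num.truncn (d / 24) in (12 * 2 ^ j <= n)%N ->
  (4 ^ j * (n %/ (3 * 2 ^ j)) < r)%N -> 2 `^ ((144 * 250)^-1 * d) * n%:R <= r%:R :> R.
Proof.
move=> d144 j jn ltr; have nR : 0 <= n%:R :> R by [].
have le1 : 4 * 2 `^ ((144 * 250)^-1 * d) * n%:R <= (2 ^ j * n)%:R :> R.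
  by rewrite natrM natrX ler_wpM2r // two_powR_large.
have : (2 ^ j * n)%:R <= (4 * r)%:R :> R.
  rewrite ler_nat; have c0 : (0 < 3 * 2 ^ j)%N by rewrite muln_gt0 expn_gt0.
  have := ltn_ceil n c0; move: ltr; rewrite (expnMn 2 2).
  move: (n %/ _)%N => w; move: (2 ^ j)%N jn {le1 c0} => c jn ltr ltn.
  have := leq_mul (leqnn c) ltn; have := leq_mul (leqnn c) jn; lia.
by rewrite natrM; lra.
Qed.

End Estimates.

Lemma ramsey_upper_tail (R : realType) (d : R) : 2 <= d ->
  exists C : R, forall n : nat, (0 < n)%N -> d / n%:R <= 1 ->
    Gnp_prob (d / n%:R) (fun G : graph 'I_n =>
      ~~ ((ramsey G)%:R <= 2 `^ (13032 * d * log2 d ^+ 2) * n%:R)) <= C / n%:R.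
Proof.
move=> d2; have [L [L0 dL leL]] := log2_bounds d2.
exists (1 + 36 * (2 ^ L)%:R ^+ 3) => n n0 p1.
have nR : 0 < n%:R :> R by rewrite ltr0n.
have p01 : 0 <= d / n%:R <= 1 by rewrite p1 andbT divr_ge0 //; lra.
have L_gt0 : (0 < 2 ^ L)%N by rewrite expn_gt0.
have pL : d / n%:R <= (2 ^ L)%:R / n%:R by rewrite ler_pM2r ?invr_gt0.
apply: (le_trans _ (sparse_graph_prob p01 L_gt0 n0 pL)); apply: Gnp_prob_le => // G.
apply: contraNN => spG; have := ramsey_sparse_le n0 L0 spG; rewrite -(ler_nat R) natrM.
move=> /le_trans; apply; rewrite ler_pM2r // natrX -(powR_mulrn _ (ler0n R 2)).
by apply: ler_powR => //; rewrite ler1n.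
Qed.

Lemma ramsey_lower_tail (R : realType) (d : R) : 2 <= d ->
  exists (C : R) (N : nat), forall n : nat, (N <= n)%N -> d / n%:R <= 1 ->
    Gnp_prob (d / n%:R) (fun G : graph 'I_n =>
      ~~ (2 `^ ((144 * 250)^-1 * d) * n%:R <= (ramsey G)%:R)) <= C / n%:R.
Proof.
move=> d2; have [d144|d144] := leP d 144.
  exists (750 + 10000), 2000%N => n n2000 p1.
  have n1 : (1 < n)%N by apply: leq_trans n2000.
  have n200 : (200 <= n)%N by apply: leq_trans n2000.
  have p01 : 0 <= d / n%:R <= 1 by rewrite p1 andbT divr_ge0 //; lra.
  rewrite (mulrDl 750).
  apply: (le_trans _ (lerD (independent_tail n1 d2 p1) (isolated_tail n1 d2 p1 n200))).
  apply: Gnp_prob_or => // G; apply: contraNT; rewrite negb_or => /andP[nind niso].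
  exact: lower_small d144 n2000 (ramsey_gt_small nind niso).
pose j := Num.truncn (d / 24).
have jd : j%:R <= d / 24.
  by have /truncn_itv/andP[] : 0 <= d / 24 by lra.
exists (24 * expR (d / 2)), (12 * 2 ^ j)%N => n jn p1.
have n0 : (0 < n)%N by apply: leq_trans jn; rewrite muln_gt0 expn_gt0.
have p01 : 0 <= d / n%:R <= 1 by rewrite p1 andbT divr_ge0 //; lra.
have d1 : 1 <= d by lra.
apply: (le_trans _ (balanced_map_tail n0 d1 p1 jd)); apply: Gnp_prob_le => // G.
apply: contraNT => nbal.
exact: lower_large (ltW d144) jn (ramsey_gt_large nbal).
Qed.

From mathcomp Require Import all_classical all_reals all_analysis.
Import numFieldNormedType.Exports.
Local Open Scope classical_set_scope.
Local Open Scope ring_scope.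

Lemma almost_surely_bound (R : realType) (p : nat -> R) (P : forall n, pred (graph 'I_n)) (C : R) :
  (\forall n \near \oo, 0 <= p n <= 1 /\
     Gnp_prob (p n) (fun G => ~~ P n G) <= C / n%:R) ->
  almost_surely p P.
Proof.
move=> bad; rewrite /almost_surely.
apply: (@squeeze_cvgr _ _ _ _ (fun n => 1 - C / n%:R) (fun=> 1)).
- near=> n; have [p01 leC] : 0 <= p n <= 1 /\ Gnp_prob (p n) (fun G => ~~ P n G) <= C / n%:R.
    by near: n.
  by rewrite Gnp_prob_le1 // andbT Gnp_probC lerD2l lerN2.
- rewrite -[X in _ --> X]subr0; apply: cvgB; first exact: cvg_cst.
  rewrite -[X in _ --> X](mulr0 C); apply: cvgMr.
  rewrite -(cvg_shiftS (fun n : nat => (n%:R^-1 : R))); exact: cvg_harmonic.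
- exact: cvg_cst.
Unshelve. all: by end_near.
Qed.

Theorem theorem1p4 (R : realType) :
  exists c1 c2 : R, [/\ 0 < c1, 0 < c2 &
    forall d : R, 2 <= d ->
      almost_surely (fun n : nat => d / n%:R)
        (fun (n : nat) (G : graph 'I_n) =>
          (2 `^ (c1 * d) * n%:R <= (ramsey G)%:R) &&
          ((ramsey G)%:R <= 2 `^ (c2 * d * (log2 d) ^+ 2) * n%:R))].
Proof.
exists (144 * 250)^-1, 13032; split=> [||d d2]; first by rewrite invr_gt0 mulr_gt0 ?ltr0n.
  by rewrite ltr0n.
have [C1 upper] := ramsey_upper_tail d2.
have [C2 [N lower]] := ramsey_lower_tail d2.
apply: (@almost_surely_bound _ _ _ (C2 + C1)); near=> n.
have n0 : (0 < n)%N by near: n; exact: nbhs_infty_gt.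
have Nn : (N <= n)%N by near: n; exact: nbhs_infty_ge.
have dn : d <= n%:R by near: n; exact: nbhs_infty_ger.
have p1 : d / n%:R <= 1 by rewrite ler_pdivrMr ?ltr0n // mul1r.
have p01 : 0 <= d / n%:R <= 1 by rewrite p1 andbT divr_ge0 // (le_trans _ d2).
split=> //; rewrite (mulrDl C2); apply: (le_trans _ (lerD (lower n Nn p1) (upper n n0 p1))).
by apply: Gnp_prob_or => // G; rewrite negb_and.
Unshelve. all: by end_near.
Qed.
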